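(* Let $\Lambda$ be a countable set and let $Q=(q(x,y))_{x,y\in\Lambda\cup\{0\}}$ be the rate matrix of a non-exploding continuous-time Markov jump process $Z$ on $\Lambda\cup\{0\}$, irreducible on $\Lambda$, for which $0$ is absorbing and absorption is certain; here $q(x,x)=-\sum_{y\neq x}q(x,y)$. Assume there is a constant $C$ with $\sum_{y\in\Lambda}q(y,x)\le C$ for all $x\in\Lambda\cup\{0\}$. Let $\mu$ be a probability measure on $\Lambda$ with $-\sum_{z\in\Lambda}\mu(z)q(z,z)<\infty$. Let $N\ge 2$ and let $(\xi(t))_{t\ge0}$ be the $N$-particle Fleming–Viot process driven by $Q$, started from a configuration $\xi(0)\in\Lambda^N$. Then for every $T>0$ and every $x\in\Lambda$, $$\sup_{0\le t\le T} E\left|m(x,\xi(t))-T_t\mu(x)\right|\le e^{5CT}\left(\frac{3}{\sqrt N}+\|\mu-m(\xi(0))\|_{TV}\right).$$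
   Context: For a probability measure $\mu$ on $\Lambda$, $Z(\cdot,\mu)$ denotes the process with initial law $\mu$, $\tau^\mu=\inf\{t>0: Z(t,\mu)=0\}$ its absorption time, and $T_t\mu(x):=P(Z(t,\mu)=x\mid \tau^\mu>t)$, $x\in\Lambda$, is the conditioned evolution. The $N$-particle Fleming–Viot process driven by $Q$ is the Markov process on $\Lambda^N$ (with $\xi(t,i)$ the position of particle $i$) with generator $$\mathcal L^N f(\xi)=\sum_{i=1}^N\sum_{x\in\Lambda}\Big[q(\xi(i),x)+q(\xi(i),0)\frac{\sum_{j\neq i}\mathbf 1\{\xi(j)=x\}}{N-1}\Big]\big(f(\xi^{i,x})-f(\xi)\big),$$ where $\xi^{i,x}(i)=x$ and $\xi^{i,x}(j)=\xi(j)$ for $j\ne i$: particles move independently with rates $Q$, and when a particle attempts to jump to $0$ it instead jumps to the position of one of the other $N-1$ particles chosen uniformly at random. For $\xi\in\Lambda^N$, $m(x,\xi):=\frac1N\sum_{i=1}^N\mathbf 1\{\xi(i)=x\}$, and $m(\xi)$ denotes the probability measure $m(\cdot,\xi)$ on $\Lambda$. $\|\cdot\|_{TV}$ is the total variation norm. *)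

(* Defs.v *)
From HB Require Import structures.
From mathcomp Require Import all_boot all_order all_algebra.
From mathcomp Require Import all_classical all_reals all_analysis.
Set Implicit Arguments. Unset Strict Implicit. Unset Printing Implicit Defensive.
Import Order.TTheory GRing.Theory Num.Theory.
Import numFieldNormedType.Exports.
Local Open Scope classical_set_scope.
Local Open Scope ring_scope.

Section FV.
Variable R : realType.

Definition rate_total (S : countType) (r : S -> S -> R) (x : S) : \bar R :=
  \esum_(y in [set y | y != x]) (r x y)%:E.

Definition backward_sol (S : countType) (r : S -> S -> R)
    (p : R -> S -> S -> R) : Prop :=
  [/\ (forall (t : R) (x y : S), 0 <= t -> 0 <= p t x y),
      (forall x y : S, p 0 x y = (x == y)%:R),
      (forall x y : S, (fun s => p s x y) @ 0^'+ --> p 0 x y),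
      (forall (t : R) (x y : S), 0 < t ->
          (\esum_(z in [set z | z != x]) (r x z * p t z y)%:E < +oo)%E) &
      (forall (t : R) (x y : S), 0 < t ->
          is_derive t 1 (fun s => p s x y)
            (- fine (rate_total r x) * p t x y
             + fine (\esum_(z in [set z | z != x]) (r x z * p t z y)%:E)))].

(* p is the transition function of the (non-exploding) continuous-time
   Markov jump process with rates r: the minimal nonnegative solution of the
   backward equation (Feller's minimal process), and it is honest
   (rows sum to 1), which is exactly non-explosion. *)
Definition markov_transition (S : countType) (r : S -> S -> R)
    (p : R -> S -> S -> R) : Prop :=
  [/\ backward_sol r p,
      (forall (t : R) (x : S), 0 <= t -> \esum_(y in [set: S]) (p t x y)%:E = 1%E) &
      (forall p', backward_sol r p' ->
         forall t x y, 0 <= t -> p t x y <= p' t x y)].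

(* Off-diagonal rates of the N-particle Fleming-Viot process driven by q
   on Lambda^N (state 0 of Lambda u {0} is None). *)
Definition fv_rate (L : countType) (N : nat) (q : option L -> option L -> R)
    (xi eta : {ffun 'I_N -> L}) : R :=
  \sum_(i < N)
    if [forall j, (j != i) ==> (xi j == eta j)] && (xi i != eta i) then
      q (Some (xi i)) (Some (eta i))
      + q (Some (xi i)) None
        * (#|[set j | (j != i) && (xi j == eta i)]|)%:R / (N.-1)%:R
    else 0.

Definition emp (L : countType) (N : nat) (xi : {ffun 'I_N -> L}) (x : L) : R :=
  (#|[set i | xi i == x]|)%:R / N%:R.

Definition law_at (L : countType) (mu : L -> R)
    (P : R -> option L -> option L -> R) (t : R) (y : option L) : \bar R :=
  \esum_(z in [set: L]) (mu z * P t (Some z) y)%:E.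

(* conditioned evolution T_t mu (x) = P(Z(t,mu)=x | tau > t);
   since 0 is absorbing, {tau > t} = {Z(t,mu) in Lambda}. *)
Definition cond_evol (L : countType) (mu : L -> R)
    (P : R -> option L -> option L -> R) (t : R) (x : L) : R :=
  fine (law_at mu P t (Some x))
  / fine (\esum_(y in [set: L]) law_at mu P t (Some y)).

Definition tv (L : countType) (mu nu : L -> R) : R :=
  fine (\esum_(z in [set: L]) (`|mu z - nu z|)%:E).

End FV.

(* Main.v *)
Require Import Defs.
From HB Require Import structures.
From mathcomp Require Import all_boot all_order all_algebra.
From mathcomp Require Import all_classical all_reals all_analysis.
From mathcomp Require Import finmap ring lra.
Import Order.TTheory GRing.Theory Num.Theory.
Import numFieldNormedType.Exports.
Local Open Scope classical_set_scope.
Local Open Scope ring_scope.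

(* Both minimal transition functions are increasing limits of those of the
   chains killed upon leaving a finite set, for which the forward equation is
   a finite linear system.  In the truncated picture put D_x = m(x) - v(x), v
   being the conditioned evolution, and consider the pair correlations
   w(x,y) = E D_x D_y - 1{x=y} E m(x) / N.  Removing the diagonal term makes
   the (possibly unbounded) jump rates enter the equation of w only through
   sum_z q(z,x) w(z,y) + sum_z q(z,y) w(x,z), which the column bound controls
   by 2 C sup w; the selection terms are at most
   4 C sup_z E D_z^2 + 8 C / N because the killing rates have sum at most C.
   Hence sup w + 2/N grows at most like e^{6Ct}, and Cauchy-Schwarz together
   with a square root yields the claim, even with e^{3Ct} in place of
   e^{5Ct}. *)

Set Implicit Arguments.
Unset Strict Implicit.
Unset Printing Implicit Defensive.

(** * Finite systems of differential inequalities *)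

(** [markov_transition] provides only the backward equation, honesty and minimality, whereas
    expectations evolve by the forward equation. On a finite set both equations come from the matrix
    exponential; hence the truncations.

    The price is killing: the killed generator of the particle system is controlled only from above,
    and only on nonnegative functions. The quantity that is propagated must therefore be a
    combination of nonnegative functions with nonnegative coefficients, and the mass lost up to the
    final time is carried along as an error, which a large enough set of configurations makes at
    most 1/(2N).

    The two truncations are not independent. A finite set of configurations is fixed first, then a
    finite set of sites containing every site that those configurations use, so that the killed
    particles and the truncated single chain live over the same sites and share the same truncated
    column bounds. *)

Lemma esum_ge_seq (R : realType) (T : choiceType) (J : set T) (a : T -> R)
    (s : seq T) : uniq s -> (forall x, x \in s -> J x) ->
  ((\sum_(x <- s) a x)%:E <= \esum_(x in J) (a x)%:E)%E.
Proof.
move=> us sJ; apply: esum_ge; exists [set` s].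
  by split; [exact: finite_seq|move=> x /=; exact: sJ].
by rewrite -sumEFin fsbig_seq.
Qed.

Lemma esum_le_seq (R : realType) (T : choiceType) (J : set T) (a : T -> R) (M : R) :
  (forall s, uniq s -> (forall x, x \in s -> J x) -> \sum_(x <- s) a x <= M) ->
  (\esum_(x in J) (a x)%:E <= M%:E)%E.
Proof.
move=> H; apply: ge_ereal_sup => /= _ [X [finX XJ]] <-.
rewrite fsbig_finite//= sumEFin lee_fin; apply: H => [|x].
  exact: finmap.fset_uniq.
by rewrite -[_ \in _]/(x \in fset_set X) in_fset_set// => /set_mem/XJ.
Qed.

Lemma esum_gt_seq (R : realType) (T : choiceType) (J : set T) (a : T -> R) (M : R) :
  (M%:E < \esum_(x in J) (a x)%:E)%E ->
  exists s, [/\ uniq s, (forall x, x \in s -> J x) & M < \sum_(x <- s) a x].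
Proof.
move=> /ereal_sup_gt[_ [X [finX XJ] <-]].
rewrite fsbig_finite//= sumEFin lte_fin => MX.
exists (finmap.enum_fset (fset_set X)); split=> // x.
by rewrite -[_ \in _]/(x \in fset_set X) in_fset_set// => /set_mem/XJ.
Qed.

Lemma sum_uniq_subset (R : nmodType) (I : eqType) (s l : seq I) (P : pred I)
    (F : I -> R) : uniq s -> uniq l -> {subset l <= s} ->
  \sum_(z <- s | P z) F z =
  \sum_(z <- l | P z) F z + \sum_(z <- s | P z && (z \notin l)) F z.
Proof.
move=> us ul ls; rewrite (bigID (mem l))/=; congr (_ + _).
have perm_l : perm_eq [seq z <- s | z \in l] l.
  apply: uniq_perm; rewrite ?filter_uniq// => z.
  by rewrite mem_filter; case: (boolP (z \in l)) => // /ls ->.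
by rewrite -(perm_big _ perm_l)/= big_filter_cond; apply: eq_bigl => z; rewrite andbC.
Qed.

(** Differentiability without division by h, the form in which estimates on the truncations pass to
    their limit in [plim_deriv]. *)
Lemma is_derive_quot (R : realType) (f : R -> R) (x d : R) :
  (forall e : R, 0 < e -> exists2 k : R, 0 < k & forall h, `|h| < k ->
     `|f (x + h) - f x - d * h| <= e * `|h|) ->
  is_derive x 1 f d.
Proof.
move=> H.
suff F : h^-1 *: (f (h + x) - f x) @[h --> 0^'] --> d.
  have Df : derivable f x 1.
    move: F; rewrite /derivable [X in X @ 0^'](_ : _ =
        (fun h => h^-1 *: (f (h%:A + x) - f x))) /=; last first.
      by apply/funext => i //=; rewrite [i%:A]mulr1.
    by move=> /(cvg_lim _) -> //.
  constructor; first exact: Df.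
  by rewrite -derive1E; apply: cvg_lim F.
apply/cvgrPdist_le => e e0.
have [k k0 hk] := H e e0.
near=> h.
have h0 : h != 0 by near: h; exact: nbhs_dnbhs_neq.
have hk' : `|h| < k.
  near: h; apply/nbhs_ballP; exists k => //= t.
  by rewrite /ball /= sub0r normrN.
have := hk h hk'; rewrite -(ler_pM2r (_ : 0 < `|h|^-1)) ?invr_gt0 ?normr_gt0//.
rewrite mulfK ?normr_eq0// -normfV -normrM.
suff -> : d - h^-1 *: (f (h + x) - f x) = - ((f (x + h) - f x - d * h) / h).
  by rewrite normrN.
by rewrite /GRing.scale/= [h + x]addrC; field.
Unshelve. all: by end_near.
Qed.

Lemma is_derive_sum_seq (R : realType) (I : eqType) (s : seq I)
    (f : I -> R -> R) (df : I -> R) (t : R) :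
  (forall i, i \in s -> is_derive t 1 (f i) (df i)) ->
  is_derive t 1 (fun u => \sum_(i <- s) f i u) (\sum_(i <- s) df i).
Proof.
elim: s => [|i s IH] H.
  rewrite big_nil (_ : (fun _ => _) = cst 0); first exact: is_derive_cst.
  by apply/funext => u; rewrite big_nil.
rewrite big_cons (_ : (fun _ => _) = f i + (fun u => \sum_(i <- s) f i u)).
  apply: is_deriveD; first by apply: H; rewrite inE eqxx.
  by apply: IH => j js; apply: H; rewrite inE js orbT.
by apply/funext => u; rewrite big_cons.
Qed.

(** The negative part is not differentiable at 0 but its square is, so Gronwall's argument needs no
    one-sided derivatives. *)
Lemma is_derive_negpart_sqr (R : realType) (x : R) :
  is_derive x 1 (fun y : R => Num.min y 0 ^+ 2) (2 * Num.min x 0).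
Proof.
apply: is_derive_quot => e e0; exists e => // h he.
suff : `|Num.min (x + h) 0 ^+ 2 - Num.min x 0 ^+ 2 - 2 * Num.min x 0 * h|
    <= `|h| * `|h|.
  by move=> /le_trans; apply; apply: ler_wpM2r => //; exact: ltW.
rewrite -normrM (ger0_norm (_ : 0 <= h * h)) -?expr2 ?sqr_ge0// ler_norml.
by apply/andP; split; case: (leP (x + h) 0); case: (leP x 0); nra.
Qed.

Lemma is_derive_right_cvg (R : realType) (f : R -> R) (x d : R) :
  is_derive x 1 f d -> f @ x^'+ --> f x.
Proof.
move=> H; have /differentiable_continuous : differentiable f x.
  by apply/derivable1_diffP.
by move=> /cvg_at_right_filter.
Qed.

Lemma is_derive_left_cvg (R : realType) (f : R -> R) (x d : R) :
  is_derive x 1 f d -> f @ x^'- --> f x.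
Proof.
move=> H; have /differentiable_continuous : differentiable f x.
  by apply/derivable1_diffP.
by move=> /cvg_at_left_filter.
Qed.

(** Only derivatives at positive times and right continuity at 0 are required, because
    [backward_sol] gives no more. *)
Lemma nonincreasing_from0 (R : realType) (f df : R -> R) (T : R) :
  (forall t : R, 0 < t <= T -> is_derive t 1 f (df t)) ->
  (forall t : R, 0 < t <= T -> df t <= 0) ->
  f @ 0^'+ --> f 0 ->
  forall t : R, 0 <= t <= T -> f t <= f 0.
Proof.
move=> fd df0 f0 t /andP[]; rewrite le_eqVlt => /predU1P[<-//|t0 tT].
have cf : {within `[0, t], continuous f}.
  apply/continuous_within_itvP => //; split => //.
    move=> u; rewrite in_itv/= => /andP[u0 ut].
    apply: differentiable_continuous; apply/derivable1_diffP.
    by have [] := fd u _ => //; rewrite u0 (le_trans (ltW ut)).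
  by apply: is_derive_left_cvg (fd t _); rewrite t0.
have fdt (u : R) : u \in `]0, t[%R -> is_derive u 1 f (df u).
  rewrite in_itv/= => /andP[u0 ut].
  by apply: fd; rewrite u0 (le_trans (ltW ut)).
have [c + E] := MVT t0 fdt cf.
rewrite in_itv/= => /andP[c0 ct].
rewrite -subr_le0 E subr0 mulr_le0_ge0 ?(ltW t0)//.
by apply: df0; rewrite c0 (le_trans (ltW ct)).
Qed.

Lemma is_derive_expRM (R : realType) (k u : R) :
  is_derive u 1 (fun t : R => expR (k * t)) (k * expR (k * u)).
Proof.
rewrite [X in is_derive _ _ X _](_ : _ = expR \o (k \*: id)); last first.
  by apply/funext.
have hid := @is_deriveZ _ _ _ id k u 1 _ (is_derive_id u (1 : R)).
have hE := @is_derive1_comp R expR (k \*: id) u _ _ (is_derive_expR _) hid.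
by apply: (is_derive_eq hE); rewrite /= /GRing.scale/= mulr1 mulrC.
Qed.

Lemma sqr_sum_le (R : realDomainType) (I : Type) (s : seq I) (a : I -> R) :
  (\sum_(j <- s) a j) ^+ 2 <= (size s)%:R * \sum_(j <- s) a j ^+ 2.
Proof.
elim: s => [|j s IH]; first by rewrite !big_nil expr0n mul0r.
rewrite !big_cons /= -[X in X%:R]addn1 natrD.
suff : 2 * (a j * \sum_(l <- s) a l) <=
    (size s)%:R * a j ^+ 2 + \sum_(l <- s) a l ^+ 2.
  by move: IH; set A := \sum_(_ <- _) _; set B := \sum_(_ <- _) _ => *; nra.
elim: s {IH} => [|l s IH]; first by rewrite !big_nil !mulr0 mul0r addr0.
rewrite !big_cons /= -[X in X%:R]addn1 natrD.
have := sqr_ge0 (a j - a l).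
move: IH; set A := \sum_(_ <- _) _; set B := \sum_(_ <- _) _ => *; nra.
Qed.

(* The sum of the squared negative parts satisfies a linear differential
   inequality, so it stays 0. *)
Lemma quasimonotone_ge0 (R : realType) (I : eqType) (s : seq I)
    (h dh : I -> R -> R) (c T : R) :
  (forall i (t : R), i \in s -> 0 < t <= T -> is_derive t 1 (h i) (dh i t)) ->
  (forall i, i \in s -> h i @ 0^'+ --> h i 0) ->
  (forall i, i \in s -> 0 <= h i 0) ->
  (forall i (t b : R), i \in s -> 0 < t <= T -> 0 <= b ->
     (forall j, j \in s -> - b <= h j t) -> h i t <= 0 ->
     - (c * b) <= dh i t) ->
  forall i (t : R), i \in s -> 0 <= t <= T -> 0 <= h i t.
Proof.
move=> hd hc h0 hm i t si tT.
pose n := (size s)%:R : R.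
pose mn (i : I) (t : R) : R := Num.min (h i t) 0.
pose F (t : R) : R := \sum_(i <- s) mn i t ^+ 2.
(* Gronwall rate: F' <= 2 |c| b^2 with b the sum of the negative parts, and b^2 <= n F by
   Cauchy-Schwarz. *)
pose k : R := 2 * `|c| * n.
pose E (t : R) : R := expR (- k * t).
have dE (u : R) : is_derive u 1 E (- k * E u) by exact: is_derive_expRM.
have dF (u : R) : 0 < u <= T ->
    is_derive u 1 F (\sum_(i <- s) 2 * mn i u * dh i u).
  move=> uT; apply: is_derive_sum_seq => j js.
  rewrite [X in is_derive _ _ X _](_ : _ =
    (fun y : R => Num.min y 0 ^+ 2) \o h j)//.
  have := hd j u js uT => hj.
  have := is_derive_negpart_sqr (h j u) => hk.
  apply: (is_derive_eq (@is_derive1_comp R _ _ _ _ _ hk hj)).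
  by rewrite /mn.
have FT (u : R) : 0 <= u <= T -> E u * F u <= E 0 * F 0.
  apply: (@nonincreasing_from0 R (E * F) (fun u : R =>
      E u *: (\sum_(i <- s) 2 * mn i u * dh i u) + F u *: (- k * E u)) T).
  - move=> v vT; have := dF v vT => ?; exact: is_deriveM.
  - move=> v vT; rewrite /GRing.scale/=.
    rewrite (_ : _ + _ = E v * (\sum_(j <- s) 2 * mn j v * dh j v - k * F v)).
      rewrite pmulr_rle0 ?expR_gt0// subr_le0.
      (* The sum, rather than the maximum, of the negative parts: it still bounds each of them, and
         the remaining sum of - mn j v is b again. *)
      pose b := \sum_(j <- s) (- mn j v).
      have mn0 j : 0 <= - mn j v by rewrite oppr_ge0 ge_min lexx orbT.
      have bj j : j \in s -> - mn j v <= b.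
        move=> js; rewrite /b (big_rem j)//= lerDl.
        by rewrite big_seq sumr_ge0.
      have b0 : 0 <= b by exact: sumr_ge0.
      have bh j : j \in s -> - b <= h j v.
        move=> js; rewrite lerNl; apply: le_trans (bj j js).
        by rewrite lerN2 ge_min lexx.
      apply: (@le_trans _ _ (2 * `|c| * b ^+ 2)).
        rewrite (_ : 2 * `|c| * b ^+ 2 =
            \sum_(j <- s) 2 * `|c| * b * (- mn j v)); last first.
          by rewrite -mulr_sumr -/b; ring.
        rewrite big_seq [leRHS]big_seq ler_sum// => j js.
        have [hj|hj] := leP (h j v) 0.
          have := hm j v b js vT b0 bh hj.
          have := ler_norm c; have := mn0 j; rewrite /mn.
          set a := Num.min _ _ => a0 c1 h1.
          have h2 : - (`|c| * b) <= dh j v.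
            apply: le_trans h1; rewrite lerN2; exact: ler_wpM2r.
          nra.
        by rewrite /mn min_r ?(ltW hj)// mulr0 mul0r oppr0 mulr0.
      rewrite /k -(mulrA _ n); apply: ler_wpM2l; first by rewrite mulr_ge0.
      rewrite /F (_ : \sum_(j <- s) mn j v ^+ 2 = \sum_(j <- s) (- mn j v) ^+ 2).
        exact: sqr_sum_le.
      by apply: eq_bigr => j _; rewrite sqrrN.
    by ring.
  - apply: cvgM; first exact: is_derive_right_cvg (dE 0).
    rewrite /F; elim: (s) hc => [|j s' IH] hc.
      rewrite big_nil (_ : (fun _ => _) = cst 0); first exact: cvg_cst.
      by apply/funext => w; rewrite big_nil.
    rewrite big_cons (_ : (fun _ => _) =
       (fun y : R => Num.min y 0 ^+ 2) \o h j \+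
          (fun u => \sum_(i <- s') mn i u ^+ 2)); last first.
      by apply/funext => w; rewrite big_cons.
    apply: cvgD.
      apply: cvg_comp; first by apply: hc; rewrite inE eqxx.
      have [+ _] := is_derive_negpart_sqr (h j 0).
      by move=> /derivable1_diffP/differentiable_continuous.
    by apply: IH => l ls; apply: hc; rewrite inE ls orbT.
have := FT t tT; rewrite [F 0]big_seq [X in E 0 * X]big1; last first.
  by move=> j js; rewrite /mn min_r ?h0// expr0n.
rewrite mulr0 pmulr_rle0 ?expR_gt0// => Ft.
rewrite leNgt; apply/negP => hi.
suff : 0 < F t by rewrite ltNge Ft.
rewrite /F (big_rem i)//= ltr_pwDl//.
  by rewrite lt_neqAle sqr_ge0 andbT eq_sym sqrf_eq0 /mn min_l ?(ltW hi)// lt_eqF.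
by apply: sumr_ge0 => j _; rewrite sqr_ge0.
Qed.

(** * Exponential of a finite matrix *)

Lemma sum_pick (R : realType) (I : eqType) (s : seq I) (F : I -> R) (y : I) :
  uniq s -> y \in s -> \sum_(z <- s) F z * (z == y)%:R = F y.
Proof.
move=> us ys; rewrite (bigD1_seq y)//= eqxx mulr1 big1 ?addr0// => z zy.
by rewrite (negPf zy) mulr0.
Qed.

Lemma is_cvg_pseries_exp (R : realType) (c : R^nat) (M B t : R) : 0 <= M ->
  (forall k, `|c k| <= M * (B ^+ k / k`!%:R)) -> cvgn (pseries c t).
Proof.
move=> M0 cB; apply: normed_cvg.
apply: (@series_le_cvg _ _ (fun k => M * exp_coeff (`|B| * `|t|) k)).
- by move=> k /=.
- by move=> k; rewrite mulr_ge0// exp_coeff_ge0// mulr_ge0.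
- move=> k /=; rewrite normrM /exp_coeff/= exprMn normrX mulrAC mulrA.
  apply: ler_wpM2r; first by rewrite exprn_ge0.
  apply: (le_trans (cB k)); apply: ler_wpM2l => //.
  by apply: ler_wpM2r; rewrite ?invr_ge0// -normrX ler_norm.
- exact: (@is_cvg_seriesZ _ _ M (is_cvg_series_exp_coeff _)).
Qed.

Lemma cvg_pseries_sum (R : realType) (I : eqType) (s : seq I) (a : I -> R)
    (c : I -> R^nat) (t : R) :
  (forall z, z \in s -> cvgn (pseries (c z) t)) ->
  pseries (fun k => \sum_(z <- s) a z * c z k) t @ \oo -->
    (\sum_(z <- s) a z * limn (pseries (c z) t)).
Proof.
elim: s => [|z s IH] H.
  rewrite big_nil (_ : pseries _ _ = cst 0); first exact: cvg_cst.
  apply/funext => n; rewrite /pseries /series/= big1// => k _.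
  by rewrite big_nil mul0r.
rewrite big_cons (_ : pseries _ _ = (fun n => a z * pseries (c z) t n) \+
    pseries (fun k => \sum_(z <- s) a z * c z k) t).
  apply: cvgD; last by apply: IH => w ws; apply: H; rewrite inE ws orbT.
  by apply: cvgMr; apply: H; rewrite inE eqxx.
apply/funext => n; rewrite /pseries /series/= mulr_sumr -big_split/=.
by apply: eq_bigr => k _; rewrite big_cons mulrDl mulrA.
Qed.

Section mexp.
Context {R : realType} {I : eqType} (G : I -> I -> R) (s : seq I).

Fixpoint mpow (k : nat) (x y : I) : R :=
  if k is k'.+1 then \sum_(z <- s) G x z * mpow k' z y else (x == y)%:R.

Definition mexp (t : R) (x y : I) : R :=
  limn (pseries (fun k => mpow k x y / k`!%:R) t).

Lemma mpowSr k x y : uniq s -> x \in s -> y \in s ->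
  mpow k.+1 x y = \sum_(z <- s) mpow k x z * G z y.
Proof.
move=> us; elim: k x y => [|k IH] x y xs ys /=.
  rewrite sum_pick// -[LHS](@sum_pick R I s (G ^~ y) x)//.
  by apply: eq_bigr => z _; rewrite mulrC eq_sym.
under eq_big_seq => z zs do rewrite [X in _ * X](IH z y zs ys) mulr_sumr.
rewrite exchange_big/=; apply: eq_bigr => z _.
by rewrite mulr_suml; apply: eq_bigr => w _; rewrite mulrA.
Qed.

Let B := \sum_(x <- s) \sum_(y <- s) `|G x y|.

Let B0 : 0 <= B.
Proof. by apply: sumr_ge0 => x _; apply: sumr_ge0. Qed.

Lemma mpow_bound k x y : x \in s -> `|mpow k x y| <= B ^+ k.
Proof.
elim: k x => [|k IH] x xs /=.
  by rewrite expr0; case: eqP; rewrite ?normr0 ?normr1.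
rewrite (le_trans (ler_norm_sum _ _ _))//.
apply: (@le_trans _ _ (\sum_(z <- s) `|G x z| * B ^+ k)).
  rewrite big_seq [leRHS]big_seq ler_sum// => z zs.
  by rewrite normrM; apply: ler_wpM2l => //; exact: IH.
rewrite -mulr_suml exprS; apply: ler_wpM2r; first exact: exprn_ge0.
rewrite [leRHS](big_rem x)//= lerDl; apply: sumr_ge0 => w _; exact: sumr_ge0.
Qed.

(** Coefficients of the j-th derivative of the exponential. Differentiation only raises j, so one
    estimate gives convergence of the series and of all its derivatives. *)
Let c j x y k : R := mpow (k + j) x y / k`!%:R.

Let cvg_c j x y t : x \in s -> cvgn (pseries (c j x y) t).
Proof.
move=> xs; apply: (@is_cvg_pseries_exp R _ (B ^+ j) B) => [|k].
  exact: exprn_ge0.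
rewrite /c normrM mulrA -exprD [X in _ * X]ger0_norm ?invr_ge0//.
by apply: ler_wpM2r; rewrite ?invr_ge0// addnC mpow_bound.
Qed.

Let diffs_c j x y : pseries_diffs (c j x y) = c j.+1 x y.
Proof.
apply/funext => k; rewrite /pseries_diffs /c addnS addSn factS natrM invfM.
by rewrite mulrCA mulVKf.
Qed.

Let mexpE t x y : mexp t x y = limn (pseries (c 0 x y) t).
Proof.
by rewrite /mexp; congr (limn (pseries _ t)); apply/funext => k; rewrite /c addn0.
Qed.

Let mexp_deriv (t : R) x y : x \in s ->
  is_derive t 1 (fun u => mexp u x y) (limn (pseries (c 1 x y) t)).
Proof.
move=> xs; rewrite (_ : (fun u => _) = (fun u => limn (pseries (c 0 x y) u))).
  rewrite -diffs_c; apply: (@pseries_snd_diffs R _ (`|t| + 1)).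
  - exact: cvg_c.
  - by rewrite diffs_c; exact: cvg_c.
  - by rewrite !diffs_c; exact: cvg_c.
  - by rewrite [X in _ < X]ger0_norm ?addr_ge0// ltrDl.
by apply/funext => u; rewrite mexpE.
Qed.

Lemma mexp_backward (t : R) x y : x \in s ->
  is_derive t 1 (fun u => mexp u x y) (\sum_(z <- s) G x z * mexp t z y).
Proof.
move=> xs; apply: (is_derive_eq (mexp_deriv t y xs)).
rewrite (_ : c 1 x y = (fun k => \sum_(z <- s) G x z * c 0 z y k)).
  under eq_bigr do rewrite mexpE.
  by apply: cvg_lim => //; apply: cvg_pseries_sum => z zs; exact: cvg_c.
apply/funext => k; rewrite /c addn1/= mulr_suml; apply: eq_bigr => z _.
by rewrite addn0 mulrA.
Qed.

(** Powers of a matrix commute with it ([mpowSr]). All evolution equations for expectations below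
    rest on this lemma, the backward one serving comparison only. *)
Lemma mexp_forward (t : R) x y : uniq s -> x \in s -> y \in s ->
  is_derive t 1 (fun u => mexp u x y) (\sum_(z <- s) mexp t x z * G z y).
Proof.
move=> us xs ys; apply: (is_derive_eq (mexp_deriv t y xs)).
rewrite (_ : c 1 x y = (fun k => \sum_(z <- s) G z y * c 0 x z k)).
  under eq_bigr do rewrite mexpE mulrC.
  by apply: cvg_lim => //; apply: cvg_pseries_sum => z zs; exact: cvg_c.
apply/funext => k; rewrite /c addn1 mpowSr// mulr_suml; apply: eq_bigr => z _.
by rewrite addn0 mulrA [G z y * _]mulrC.
Qed.

Lemma mexp0 x y : mexp 0 x y = (x == y)%:R.
Proof.
rewrite /mexp; apply: cvg_lim => //.
rewrite -cvg_shiftS (_ : (fun n => _) = cst (x == y)%:R); first exact: cvg_cst.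
apply/funext => n; rewrite /pseries /series/= big_nat_recl//= fact0 divr1 mulr1.
by rewrite big1 ?addr0// => k _; rewrite expr0n mulr0.
Qed.

Lemma mexp_right_cvg x y : x \in s ->
  (fun u => mexp u x y) @ 0^'+ --> mexp 0 x y.
Proof. by move=> xs; exact: (is_derive_right_cvg (mexp_backward 0 y xs)). Qed.

End mexp.

(** * Truncation of a Markov chain to a finite set *)

Lemma lipschitz_derive (R : realType) (f df : R -> R) (K a b : R) :
  (forall t : R, is_derive t 1 f (df t)) ->
  (forall t, Num.min a b <= t <= Num.max a b -> `|df t| <= K) ->
  `|f b - f a| <= K * `|b - a|.
Proof.
wlog ab : a b / a <= b => [H fd dfK|fd].
  have [ab|/ltW ba] := leP a b; first exact: H.
  by rewrite distrC (distrC b); apply: H => // t; rewrite minC maxC; exact: dfK.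
rewrite min_l// max_r// => dfK.
have cf : {within `[a, b], continuous f}.
  apply: continuous_subspaceT => x; apply: differentiable_continuous.
  by apply/derivable1_diffP; have [] := fd x.
have [c + ->] := MVT_segment ab (fun x _ => fd x) cf.
by rewrite in_itv/= normrM => cab; apply: ler_wpM2r => //; exact: dfK.
Qed.

Lemma between_dist (R : realDomainType) (a b u : R) :
  Num.min a b <= u <= Num.max a b -> `|u - a| <= `|b - a|.
Proof.
move=> /andP[]; case: (leP a b) => ab au ub.
  by rewrite !ger0_norm ?subr_ge0// lerD2r.
by rewrite !ler0_norm ?subr_le0 ?(ltW ab)// lerN2 lerD2r.
Qed.

Definition exit_rate (R : realType) (S : countType) (r : S -> S -> R) (x : S) : R :=
  fine (rate_total r x).

Definition gen (R : realType) (S : countType) (r : S -> S -> R) (x y : S) : R :=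
  if x == y then - exit_rate r x else r x y.

(* Transition function of the chain killed upon leaving the finite set s. *)
Definition trunc (R : realType) (S : countType) (r : S -> S -> R) (s : seq S)
    (t : R) (x y : S) : R :=
  if (x \in s) && (y \in s) then mexp (gen r) s t x y else 0.

Section truncation.
Context {R : realType} {S : countType} (r : S -> S -> R).
Hypothesis r_ge0 : forall x y, x != y -> 0 <= r x y.
Hypothesis r_fin : forall x, (rate_total r x < +oo)%E.

Lemma exit_rateE x : (exit_rate r x)%:E = rate_total r x.
Proof.
rewrite /exit_rate fineK// fin_numE -ltey r_fin andbT -ltNye.
apply: (lt_le_trans (ltNy0)); apply: esum_ge0 => y /= yx.
by rewrite lee_fin r_ge0// eq_sym.
Qed.

Lemma exit_rate_ge_seq x (s : seq S) : uniq s ->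
  \sum_(z <- s | z != x) r x z <= exit_rate r x.
Proof.
move=> us; rewrite -lee_fin exit_rateE -big_filter; apply: esum_ge_seq.
  exact: filter_uniq.
by move=> z; rewrite mem_filter => /andP[].
Qed.

Lemma exit_rate_ge0 x : 0 <= exit_rate r x.
Proof. by have := @exit_rate_ge_seq x [::] erefl; rewrite big_nil. Qed.

Lemma gen_sum (s : seq S) x (f : S -> R) : uniq s -> x \in s ->
  \sum_(z <- s) gen r x z * f z =
  - exit_rate r x * f x + \sum_(z <- s | z != x) r x z * f z.
Proof.
move=> us xs; rewrite (bigD1_seq x)//= {1}/gen eqxx; congr (_ + _).
by apply: eq_bigr => z zx; rewrite /gen eq_sym (negPf zx).
Qed.

(** Minimum principle. Off-diagonal rates are nonnegative and the part of row i inside s sums to at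
    most the exit rate, so where h i is nonpositive its derivative is at least - exit_rate r i times
    any bound on the negative parts. *)
Lemma gen_comparison (s : seq S) (h dh : S -> R -> R) : uniq s ->
  (forall i (t : R), i \in s -> 0 < t -> is_derive t 1 (h i) (dh i t)) ->
  (forall i, i \in s -> h i @ 0^'+ --> h i 0) ->
  (forall i, i \in s -> 0 <= h i 0) ->
  (forall i (t : R), i \in s -> 0 < t ->
    - exit_rate r i * h i t + \sum_(z <- s | z != i) r i z * h z t <= dh i t) ->
  forall i (t : R), i \in s -> 0 <= t -> 0 <= h i t.
Proof.
move=> us hd hc h0 hdh i t si t0.
apply: (@quasimonotone_ge0 R S s h dh (\sum_(x <- s) exit_rate r x) t) => //.
- by move=> j u js /andP[u0 _]; exact: hd.
- move=> j u b js /andP[u0 _] b0 hb hj.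
  apply: le_trans (hdh j u js u0).
  apply: (@le_trans _ _ (- exit_rate r j * b)).
    rewrite mulNr lerN2; apply: ler_wpM2r => //.
    by rewrite (big_rem j)//= lerDl sumr_ge0// => k _; exact: exit_rate_ge0.
  apply: (@le_trans _ _ (\sum_(z <- s | z != j) r j z * h z u)); last first.
    by rewrite lerDr mulr_le0// oppr_le0 exit_rate_ge0.
  apply: (@le_trans _ _ (\sum_(z <- s | z != j) r j z * (- b))).
    rewrite -mulr_suml mulrN mulNr lerN2; apply: ler_wpM2r => //.
    exact: exit_rate_ge_seq.
  rewrite big_seq_cond [leRHS]big_seq_cond ler_sum// => z /andP[zs zj].
  by apply: ler_wpM2l; [rewrite r_ge0// eq_sym|exact: hb].
- by rewrite t0 lexx.
Qed.

Lemma mexp_ge0 (s : seq S) (t : R) x y : uniq s -> x \in s -> 0 <= t ->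
  0 <= mexp (gen r) s t x y.
Proof.
move=> us xs t0.
apply: (@gen_comparison s (fun x u => mexp (gen r) s u x y)
  (fun x u => \sum_(z <- s) gen r x z * mexp (gen r) s u z y)) => //.
- by move=> i u si _; exact: mexp_backward.
- by move=> i si; exact: mexp_right_cvg.
- by move=> i _; rewrite mexp0.
- by move=> i u si _; rewrite gen_sum.
Qed.

(** Applied to an arbitrary backward solution and to the exponential over a larger set. In both
    cases restricting the sum over z to s drops nonnegative terms, hence an inequality in place of
    the equation. *)
Lemma mexp_le_super (s : seq S) (u du : S -> R -> R) (y : S) : uniq s ->
  (forall i (t : R), i \in s -> 0 < t -> is_derive t 1 (u i) (du i t)) ->
  (forall i, i \in s -> u i @ 0^'+ --> u i 0) ->
  (forall i, i \in s -> (i == y)%:R <= u i 0) ->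
  (forall i (t : R), i \in s -> 0 < t ->
    - exit_rate r i * u i t + \sum_(z <- s | z != i) r i z * u z t <= du i t) ->
  forall i (t : R), i \in s -> 0 <= t -> mexp (gen r) s t i y <= u i t.
Proof.
move=> us ud uc u0 udu i t si t0; rewrite -subr_ge0.
apply: (@gen_comparison s (fun x v => u x v - mexp (gen r) s v x y)
  (fun x v => du x v - \sum_(z <- s) gen r x z * mexp (gen r) s v z y)) => //.
- move=> j v js v0; have := ud j v js v0 => ?.
  have := @mexp_backward R S (gen r) s v j y js => ?.
  exact: is_deriveB.
- by move=> j js; apply: cvgB; [exact: uc|exact: mexp_right_cvg].
- by move=> j js; rewrite mexp0 subr_ge0 u0.
- move=> j v js v0; rewrite gen_sum//.
  have := udu j v js v0.
  under [in X in _ -> X]eq_bigr do rewrite mulrBr.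
  rewrite sumrB; set A := \sum_(_ <- _ | _) _; set B := \sum_(_ <- _ | _) _; lra.
Qed.

Lemma trunc_ge0 s (t : R) x y : uniq s -> 0 <= t -> 0 <= trunc r s t x y.
Proof.
by move=> us t0; rewrite /trunc; case: ifP => // /andP[xs ys]; exact: mexp_ge0.
Qed.

Lemma trunc_le_sol s p (t : R) x y : uniq s -> backward_sol r p -> 0 <= t ->
  trunc r s t x y <= p t x y.
Proof.
move=> us [p0 pI pc psum pd] t0; rewrite /trunc.
case: ifP => [/andP[xs ys]|_]; last exact: p0.
apply: (@mexp_le_super s (fun x u => p u x y) (fun x u =>
  - fine (rate_total r x) * p u x y
    + fine (\esum_(z in [set z | z != x]) (r x z * p u z y)%:E))) => //.
- by move=> i _; rewrite pI.
- move=> i u si u0; rewrite lerD2l -lee_fin fineK; last first.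
    rewrite fin_numE -ltey psum// andbT -ltNye.
    apply: (lt_le_trans ltNy0); apply: esum_ge0 => z /= zi.
    by rewrite lee_fin mulr_ge0 ?r_ge0 1?eq_sym// p0// ltW.
  rewrite -big_filter; apply: esum_ge_seq; first exact: filter_uniq.
  by move=> z; rewrite mem_filter => /andP[].
Qed.

Lemma trunc_mono s s' (t : R) x y : uniq s -> uniq s' -> {subset s <= s'} ->
  0 <= t -> trunc r s t x y <= trunc r s' t x y.
Proof.
move=> us us' ss' t0; rewrite {1}/trunc.
case: ifP => [/andP[xs ys]|_]; last exact: trunc_ge0.
rewrite /trunc !ss'//=.
apply: (@mexp_le_super s (fun x u => mexp (gen r) s' u x y)
  (fun x u => \sum_(z <- s') gen r x z * mexp (gen r) s' u z y)) => //.
- by move=> i u si _; apply: mexp_backward; exact: ss'.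
- by move=> i si; apply: mexp_right_cvg; exact: ss'.
- by move=> i _; rewrite mexp0.
- move=> i u si u0; rewrite gen_sum ?ss'// lerD2l.
  rewrite [leRHS](sum_uniq_subset _ _ us' us ss') lerDl.
  rewrite big_seq_cond sumr_ge0// => z /and3P[zs zi _].
  by rewrite mulr_ge0 ?r_ge0 1?eq_sym//; apply: mexp_ge0 => //; rewrite ltW.
Qed.
End truncation.

(** * Convergence of the truncations to the minimal solution *)

Section minimal_limit.
Context {R : realType} {S : countType} (r : S -> S -> R) (p : R -> S -> S -> R).
Hypothesis r_ge0 : forall x y, x != y -> 0 <= r x y.
Hypothesis r_fin : forall x, (rate_total r x < +oo)%E.
Hypothesis Hp : markov_transition r p.

Let p_sol : backward_sol r p. Proof. by have [] := Hp. Qed.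

Lemma markov_ge0 (t : R) x y : 0 <= t -> 0 <= p t x y.
Proof. by have [H _ _ _ _] := p_sol; exact: H. Qed.

Lemma markov_sum_le1 (t : R) x (l : seq S) : uniq l -> 0 <= t ->
  \sum_(y <- l) p t x y <= 1.
Proof.
move=> ul t0; have [_ H _] := Hp.
by rewrite -lee_fin -(H t x t0); exact: esum_ge_seq.
Qed.

Lemma markov_le1 (t : R) x y : 0 <= t -> p t x y <= 1.
Proof.
by move=> t0; have := @markov_sum_le1 t x [:: y] erefl t0; rewrite big_seq1.
Qed.

Let trunc_le s (t : R) x y : uniq s -> 0 <= t -> trunc r s t x y <= p t x y.
Proof. by move=> us t0; exact: trunc_le_sol. Qed.

Lemma trunc_le1 s (t : R) x y : uniq s -> 0 <= t -> trunc r s t x y <= 1.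
Proof. by move=> us t0; rewrite (le_trans (trunc_le _ _ _ _))// markov_le1. Qed.

Lemma trunc_sum_le1 s (t : R) x (l : seq S) : uniq s -> uniq l -> 0 <= t ->
  \sum_(y <- l) trunc r s t x y <= 1.
Proof.
move=> us ul t0; apply: le_trans (markov_sum_le1 x ul t0).
by apply: ler_sum => y _; exact: trunc_le.
Qed.

(** Outside l a function with values in [0, 1] costs at most the exit rate that l misses, a bound
    that does not depend on s. *)
Let tail_le s x (f : S -> R) (l : seq S) : uniq s -> uniq l ->
  {subset l <= s} -> (forall z, 0 <= f z <= 1) ->
  \sum_(z <- s | z != x) r x z * f z <=
  \sum_(z <- l | z != x) r x z * f z +
  (exit_rate r x - \sum_(z <- l | z != x) r x z).
Proof.
move=> us ul ls f01.
have split_l (F : S -> R) := sum_uniq_subset (fun z => z != x) F us ul ls.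
rewrite (split_l (fun z => r x z * f z)) lerD2l.
have := exit_rate_ge_seq r_ge0 r_fin x us.
rewrite (split_l (r x)) -lerBrDl => H; apply: le_trans H.
apply: ler_sum => z /andP[zx _]; rewrite ler_piMr ?r_ge0 1?eq_sym//.
by have /andP[] := f01 z.
Qed.

(** A supremum over all finite lists needs no enumeration of S. By [trunc_mono] the family is
    directed, so it is also a limit, attained up to e at finitely many points at once. *)
Definition plim (t : R) x y :=
  sup [set trunc r s t x y | s in [set s : seq S | uniq s]].

Let plim_has_sup (t : R) x y : 0 <= t ->
  has_sup [set trunc r s t x y | s in [set s : seq S | uniq s]].
Proof.
move=> t0; split; first by exists (trunc r [::] t x y), [::].
by exists 1 => _ [s us <-]; exact: trunc_le1.
Qed.

Let trunc_le_plim s (t : R) x y : uniq s -> 0 <= t -> trunc r s t x y <= plim t x y.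
Proof.
by move=> us t0; apply: ub_le_sup; [have [] := plim_has_sup x y t0|exists s].
Qed.

Let plim_ge0 (t : R) x y : 0 <= t -> 0 <= plim t x y.
Proof. by move=> t0; apply: (le_trans _ (@trunc_le_plim [::] _ _ _ _ t0)). Qed.

Let plim_le (t : R) x y : 0 <= t -> plim t x y <= p t x y.
Proof.
move=> t0; apply: ge_sup; first by have [] := plim_has_sup x y t0.
by move=> _ [s us <-]; exact: trunc_le.
Qed.

Let plim_le1 (t : R) x y : 0 <= t -> plim t x y <= 1.
Proof. by move=> t0; rewrite (le_trans (plim_le _ _ _))// markov_le1. Qed.

Let plim_approx (e t : R) y (l : seq S) : 0 < e -> 0 <= t ->
  exists2 s0 : seq S, uniq s0 & forall s, uniq s -> {subset s0 <= s} ->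
    forall z, z \in l -> `|plim t z y - trunc r s t z y| <= e.
Proof.
move=> e0 t0; elim: l => [|x l [s0 us0 IH]]; first by exists [::].
have [_ [s1 us1 <-] H] := sup_adherent e0 (plim_has_sup x y t0).
exists (undup (s0 ++ s1)); first exact: undup_uniq.
move=> s us ss z; rewrite inE => /predU1P[->|zl]; last first.
  by apply: IH => // w ws; apply: ss; rewrite mem_undup mem_cat ws.
rewrite ger0_norm ?subr_ge0 ?trunc_le_plim// lerBlDr -lerBlDl.
apply: (le_trans (ltW H)); apply: trunc_mono => // w ws; apply: ss.
by rewrite mem_undup mem_cat ws orbT.
Qed.

Let trunc_deriv s (t : R) x y : uniq s -> x \in s -> y \in s ->
  is_derive t 1 (fun u => trunc r s u x y)
    (- exit_rate r x * trunc r s t x y +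
     \sum_(z <- s | z != x) r x z * trunc r s t z y).
Proof.
move=> us xs ys.
rewrite (_ : (fun u => _) = (fun u => mexp (gen r) s u x y)).
  apply: (is_derive_eq (mexp_backward _ _ _ xs)).
  rewrite gen_sum// /trunc xs ys/=; congr (_ + _).
  by rewrite big_seq_cond [RHS]big_seq_cond; apply: eq_bigr => z /andP[-> _].
by apply/funext => u; rewrite /trunc xs ys.
Qed.

Let rsum_01 s (t : R) x y : uniq s -> 0 <= t ->
  0 <= \sum_(z <- s | z != x) r x z * trunc r s t z y <= exit_rate r x.
Proof.
move=> us t0; apply/andP; split.
  by apply: sumr_ge0 => z zx; rewrite mulr_ge0 ?r_ge0 1?eq_sym ?trunc_ge0.
apply: le_trans (exit_rate_ge_seq r_ge0 r_fin x us).
apply: ler_sum => z zx; rewrite ler_piMr ?r_ge0 1?eq_sym//; exact: trunc_le1.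
Qed.

(** The derivative is a difference of two numbers in [0, exit_rate r x]; the Lipschitz constant is
    therefore the same for all s. *)
Let trunc_lip s (t u : R) x y : uniq s -> 0 <= t -> 0 <= u ->
  `|trunc r s t x y - trunc r s u x y| <= exit_rate r x * `|t - u|.
Proof.
move=> us t0 u0.
have [/andP[xs ys]|xys] := boolP ((x \in s) && (y \in s)); last first.
  by rewrite /trunc (negPf xys) subrr normr0 mulr_ge0// exit_rate_ge0.
apply: (@lipschitz_derive R (fun u => trunc r s u x y) (fun t =>
  - exit_rate r x * trunc r s t x y +
     \sum_(z <- s | z != x) r x z * trunc r s t z y)) => [v|v /andP[v1 _]].
  exact: trunc_deriv.
have v0 : 0 <= v by apply: le_trans v1; rewrite le_min t0 u0.
have := rsum_01 x y us v0.
have := trunc_ge0 r_ge0 r_fin x y us v0; have := trunc_le1 x y us v0.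
have := exit_rate_ge0 r_ge0 r_fin x.
set A := \sum_(_ <- _ | _) _; set B := trunc _ _ _ _ _; set K := exit_rate _ _.
by move=> ? ? ? /andP[? ?]; rewrite ler_norml; apply/andP; split; nra.
Qed.

Let plim_lip (t u : R) x y : 0 <= t -> 0 <= u ->
  `|plim t x y - plim u x y| <= exit_rate r x * `|t - u|.
Proof.
move=> t0 u0; apply/ler_addgt0Pr => e e0.
have e20 : 0 < e / 2 by rewrite divr_gt0.
have [s1 us1 H1] := plim_approx y [:: x] e20 t0.
have [s2 us2 H2] := plim_approx y [:: x] e20 u0.
pose s := undup (s1 ++ s2); have us : uniq s := undup_uniq _.
have := trunc_lip x y us t0 u0.
have s1s : {subset s1 <= s} by move=> w ws; rewrite mem_undup mem_cat ws.
have s2s : {subset s2 <= s} by move=> w ws; rewrite mem_undup mem_cat ws orbT.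
have := H1 s us s1s x (mem_head _ _); have := H2 s us s2s x (mem_head _ _).
set K := exit_rate _ _ * _; rewrite !ler_norml => /andP[? ?] /andP[? ?] /andP[? ?].
apply/andP; split; lra.
Qed.

Let plim_init x y : plim 0 x y = (x == y)%:R.
Proof.
apply/eqP; rewrite -subr_eq0 -normr_le0; apply/ler_addgt0Pr => e e0.
rewrite add0r; have [s0 us0 H] := plim_approx y [:: x] e0 (lexx 0).
pose s := undup [:: x, y & s0].
have := H s (undup_uniq _) _ x (mem_head _ _).
rewrite /trunc !mem_undup !inE !eqxx !orbT mexp0; apply.
by move=> w ws; rewrite mem_undup !inE ws !orbT.
Qed.

Let rplim_fin (t : R) x y : 0 <= t ->
  (\esum_(z in [set z | z != x]) (r x z * plim t z y)%:E < +oo)%E.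
Proof.
move=> t0; apply: le_lt_trans (r_fin x); apply: le_esum => z /= zx.
by rewrite lee_fin ler_piMr ?plim_le1 ?r_ge0 1?eq_sym.
Qed.

Let rplim_approx (t e : R) x y (l : seq S) : 0 <= t -> uniq l ->
  exit_rate r x - \sum_(z <- l | z != x) r x z <= e ->
  \sum_(z <- l | z != x) r x z * plim t z y <=
  fine (\esum_(z in [set z | z != x]) (r x z * plim t z y)%:E) <=
  \sum_(z <- l | z != x) r x z * plim t z y + e.
Proof.
move=> t0 ul le.
have W : (fine (\esum_(z in [set z | z != x]) (r x z * plim t z y)%:E))%:E =
    \esum_(z in [set z | z != x]) (r x z * plim t z y)%:E.
  rewrite fineK// fin_numE -ltey rplim_fin// andbT -ltNye.
  apply: (lt_le_trans (ltNy0)); apply: esum_ge0 => z /= zx.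
  by rewrite lee_fin mulr_ge0 ?plim_ge0// r_ge0// eq_sym.
rewrite -!lee_fin W; apply/andP; split.
  rewrite -big_filter; apply: esum_ge_seq; first exact: filter_uniq.
  by move=> z; rewrite mem_filter => /andP[].
apply: esum_le_seq => s us sx.
pose s' := undup (s ++ l).
apply: (@le_trans _ _ (\sum_(z <- s' | z != x) r x z * plim t z y)).
  rewrite (_ : \sum_(z <- s' | _) _ = \sum_(z <- s) r x z * plim t z y +
     \sum_(z <- s' | (z != x) && (z \notin s)) r x z * plim t z y).
    rewrite lerDl; apply: sumr_ge0 => z /andP[zx _].
    by rewrite mulr_ge0 ?plim_ge0// r_ge0// eq_sym.
  rewrite (bigID (mem s))/= -big_filter.
  congr (_ + _); apply: perm_big; apply: uniq_perm => //.
    by rewrite filter_uniq// undup_uniq.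
  move=> z; rewrite mem_filter mem_undup mem_cat -andbA.
  by case: (boolP (z \in s)) => [zs|_]; rewrite ?andbF//= andbT; exact: sx.
apply: (@le_trans _ _ (\sum_(z <- l | z != x) r x z * plim t z y +
  (exit_rate r x - \sum_(z <- l | z != x) r x z))); last by rewrite lerD2l.
apply: tail_le => //; first exact: undup_uniq.
  by move=> z zl; rewrite mem_undup mem_cat zl orbT.
by move=> z; rewrite plim_ge0//= plim_le1.
Qed.

(** By the mean value theorem it is enough that the derivative of a large truncation stays within e
    of d between t and t + h. A finite list l carries all but e/8 of the exit rate, and on l the
    Lipschitz bounds are uniform in s. *)
Let plim_deriv (t : R) x y : 0 < t ->
  is_derive t 1 (fun s => plim s x y)
   (- fine (rate_total r x) * plim t x y
    + fine (\esum_(z in [set z | z != x]) (r x z * plim t z y)%:E)).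
Proof.
move=> t0; apply: is_derive_quot => e e0.
have e8 : 0 < e / 8 by rewrite divr_gt0.
have [l [ul lx Hl]] : exists l : seq S, [/\ uniq l, (forall z, z \in l -> z != x) &
    exit_rate r x - \sum_(z <- l | z != x) r x z <= e / 8].
  have [|l [ul lx Hl]] :=
      @esum_gt_seq R S [set z | z != x] (r x) (exit_rate r x - e / 8).
    by rewrite -[X in (_ < X)%E]/(rate_total r x) -exit_rateE// lte_fin ltrBlDr ltrDl.
  have {}lx : forall z, z \in l -> z != x := lx.
  exists l; split => //; rewrite (_ : \sum_(z <- l | _) _ = \sum_(z <- l) r x z).
    by rewrite lerBlDr -lerBlDl ltW.
  rewrite [RHS]big_seq [LHS]big_seq_cond; apply: eq_bigl => z.
  by apply/andP/idP => [[]//|zl]; split => //; exact: lx.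
(* K |h| bounds the variation in time of the terms kept, and K1 del the error of replacing [plim] by
   a truncation; each is given e/4, and each tail e/8. *)
pose K := exit_rate r x * exit_rate r x + \sum_(z <- l | z != x) r x z * exit_rate r z.
pose K1 := exit_rate r x + \sum_(z <- l | z != x) r x z.
have K0 : 0 <= K.
  rewrite addr_ge0 ?mulr_ge0 ?exit_rate_ge0//; apply: sumr_ge0 => z zx.
  by rewrite mulr_ge0 ?exit_rate_ge0 ?r_ge0 1?eq_sym.
have K10 : 0 <= K1.
  by rewrite addr_ge0 ?exit_rate_ge0// sumr_ge0// => z zx; rewrite r_ge0 1?eq_sym.
exists (Num.min t (e / (4 * (K + 1)))).
  by rewrite lt_min t0 divr_gt0// mulr_gt0// ltr_wpDl.
move=> h; rewrite lt_min => /andP[ht hK].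
have th0 : 0 <= t + h by move: ht; rewrite ltr_norml => /andP[? _]; lra.
have {}hK : K * `|h| <= e / 4.
  move: hK; rewrite ltr_pdivlMr ?mulr_gt0 ?ltr_wpDl// => hK.
  have := normr_ge0 h; nra.
set d := - fine _ * _ + fine _.
(* The truncation must be accurate at t and at t + h, so it depends on h. Its error at these two
   times has a tolerance e' of its own, which tends to 0 while h is fixed. *)
apply/ler_addgt0Pr => e' e'0.
pose del := Num.min (e' / 2) (e / (4 * (K1 + 1))).
have del0 : 0 < del by rewrite lt_min !divr_gt0// mulr_gt0// ltr_wpDl.
have del1 : 2 * del <= e'.
  have : del <= e' / 2 by rewrite ge_min lexx.
  lra.
have del2 : K1 * del <= e / 4.
  have : del <= e / (4 * (K1 + 1)) by rewrite ge_min lexx orbT.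
  by rewrite ler_pdivlMr ?mulr_gt0 ?ltr_wpDl// => ?; nra.
have [s1 us1 H1] := plim_approx y (x :: l) del0 (ltW t0).
have [s2 us2 H2] := plim_approx y [:: x] del0 th0.
pose s := undup ([:: x; y] ++ l ++ s1 ++ s2).
have us : uniq s := undup_uniq _.
have s1s : {subset s1 <= s} by move=> z zs; rewrite mem_undup !mem_cat zs !orbT.
have s2s : {subset s2 <= s} by move=> z zs; rewrite mem_undup !mem_cat zs !orbT.
have ls : {subset l <= s} by move=> z zs; rewrite mem_undup !mem_cat zs !orbT.
have xs : x \in s by rewrite mem_undup !mem_cat !inE eqxx.
have ys : y \in s by rewrite mem_undup !mem_cat !inE eqxx orbT.
have {}H1 := H1 s us s1s; have {H2}H2 := H2 s us s2s x (mem_head _ _).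
pose phi u := - exit_rate r x * trunc r s u x y +
     \sum_(z <- s | z != x) r x z * trunc r s u z y.
have key c : 0 <= c -> `|c - t| <= `|h| -> `|phi c - d| <= e.
  move=> c0 ct.
  have cl z : z \in x :: l ->
      `|trunc r s c z y - plim t z y| <= exit_rate r z * `|h| + del.
    move=> zl; have := H1 z zl; have := trunc_lip z y us c0 (ltW t0).
    have : exit_rate r z * `|c - t| <= exit_rate r z * `|h|.
      by apply: ler_wpM2l => //; exact: exit_rate_ge0.
    set u := exit_rate r z * _; set v := exit_rate r z * _ => uv.
    rewrite !ler_norml => /andP[? ?] /andP[? ?]; apply/andP; split; lra.
  have /andP[w1 w2] := @rplim_approx t (e / 8) x y l (ltW t0) ul Hl.
  have z1 : \sum_(z <- l | z != x) r x z * trunc r s c z y <=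
      \sum_(z <- s | z != x) r x z * trunc r s c z y.
    rewrite [leRHS](sum_uniq_subset _ _ us ul ls) lerDl.
    apply: sumr_ge0 => z /andP[zx _].
    by rewrite mulr_ge0 ?r_ge0 1?eq_sym ?trunc_ge0.
  have t01 z : 0 <= trunc r s c z y <= 1.
    by rewrite (trunc_ge0 r_ge0 r_fin)//= trunc_le1.
  have z2 : \sum_(z <- s | z != x) r x z * trunc r s c z y <=
    \sum_(z <- l | z != x) r x z * trunc r s c z y + e / 8.
    by apply: (le_trans (tail_le x us ul ls t01)); rewrite lerD2l.
  have z3 : `|\sum_(z <- l | z != x) r x z * trunc r s c z y -
     \sum_(z <- l | z != x) r x z * plim t z y| <=
     \sum_(z <- l | z != x) (r x z * exit_rate r z * `|h| + r x z * del).
    rewrite -sumrB; apply: (le_trans (ler_norm_sum _ _ _)).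
    rewrite big_seq_cond [leRHS]big_seq_cond; apply: ler_sum => z /andP[zl zx].
    have rz : 0 <= r x z by rewrite r_ge0 1?eq_sym.
    rewrite -mulrBr normrM (ger0_norm rz) -mulrA -mulrDr; apply: ler_wpM2l => //.
    by apply: cl; rewrite inE zl orbT.
  rewrite big_split/= -!mulr_suml in z3.
  have z4 := cl x (mem_head _ _).
  have z5 : `|exit_rate r x * trunc r s c x y - exit_rate r x * plim t x y| <=
     exit_rate r x * exit_rate r x * `|h| + exit_rate r x * del.
    rewrite -mulrBr normrM ger0_norm ?exit_rate_ge0// -mulrA -mulrDr.
    by apply: ler_wpM2l => //; exact: exit_rate_ge0.
  move: hK del2; rewrite /K /K1 !mulrDl /phi /d.
  rewrite -[fine (rate_total r x)]/(exit_rate r x).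
  move: w1 w2 z1 z2 z3 z5; rewrite !mulNr.
  set W := fine _.
  set A0 := \sum_(z <- l | z != x) r x z * plim t z y.
  set A1 := \sum_(z <- l | z != x) r x z * trunc r s c z y.
  set A2 := \sum_(z <- s | z != x) r x z * trunc r s c z y.
  set A3 := \sum_(z <- l | z != x) r x z * exit_rate r z.
  set A4 := \sum_(z <- l | z != x) r x z.
  set B1 := exit_rate r x * trunc _ _ _ _ _; set B2 := exit_rate r x * plim _ _ _.
  rewrite !ler_norml => ? ? ? ? /andP[? ?] /andP[? ?] ? ?.
  apply/andP; split; lra.
have [->|h0] := eqVneq h 0.
  by rewrite addr0 subrr mulr0 subrr !normr0 mulr0 add0r ltW.
have Hh : `|trunc r s (t + h) x y - trunc r s t x y - d * h| <= e * `|h|.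
  pose g u := trunc r s u x y - d * u.
  have gd (u : R) : is_derive u 1 g (phi u - d).
    apply: is_deriveB; first exact: trunc_deriv.
    apply: (is_derive_eq (@is_deriveZ _ _ _ id d u 1 _ (is_derive_id u (1 : R)))).
    by rewrite /GRing.scale/= mulr1.
  have := @lipschitz_derive R g _ e t (t + h) gd _.
  rewrite {1 2}/g (_ : _ - _ - (_ - _) =
    trunc r s (t + h) x y - trunc r s t x y - d * h).
    rewrite (_ : t + h - t = h); last by ring.
    apply => u uth; apply: key; last first.
      by have := between_dist uth; rewrite (_ : t + h - t = h)//; ring.
    have /andP[u1 _] := uth.
    by apply: le_trans u1; rewrite le_min th0 ltW.
  by ring.
have := H1 x (mem_head _ _).
move: H2 Hh; rewrite !ler_norml => /andP[? ?] /andP[? ?] /andP[? ?].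
by apply/andP; split; lra.
Qed.

Lemma plim_backward_sol : backward_sol r plim.
Proof.
split.
- by move=> t x y t0; exact: plim_ge0.
- exact: plim_init.
- move=> x y; apply/cvgrPdist_le => e e0; near=> u.
  have u0 : 0 <= u by near: u; exact: nbhs_right_ge.
  rewrite (le_trans (plim_lip x y (lexx 0) u0))// sub0r normrN ger0_norm//.
  have : u <= e / (exit_rate r x + 1).
    near: u; apply: nbhs_right_le.
    by rewrite divr_gt0// ltr_wpDl// exit_rate_ge0.
  have := exit_rate_ge0 r_ge0 r_fin x => K0.
  rewrite ler_pdivlMr ?ltr_wpDl// => H; nra.
- by move=> t x y t0; apply: rplim_fin; exact: ltW.
- by move=> t x y t0; exact: plim_deriv.
Unshelve. all: by end_near.
Qed.

(** Since [plim] solves the backward equation, minimality puts p below it. Every s containing s0 is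
    allowed, so that several approximations can share one s. *)
Lemma trunc_approx (e t : R) (F : seq (S * S)) : 0 < e -> 0 <= t ->
  exists s0 : seq S, forall s, uniq s -> {subset s0 <= s} ->
    forall x y, (x, y) \in F -> p t x y - e <= trunc r s t x y.
Proof.
move=> e0 t0; elim: F => [|[x y] F [s0 IH]]; first by exists [::].
have [s1 us1 H] := plim_approx y [:: x] e0 t0.
exists (s0 ++ s1) => s us ss z w; rewrite inE => /predU1P[[-> ->]|zw]; last first.
  by apply: IH => // v vs; apply: ss; rewrite mem_cat vs.
have s1s : {subset s1 <= s} by move=> v vs; apply: ss; rewrite mem_cat vs orbT.
have := H s us s1s x (mem_head _ _); have [_ _ pmin] := Hp.
have := pmin _ plim_backward_sol t x y t0.
by rewrite ler_norml => ? /andP[_ ?]; lra.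
Qed.

End minimal_limit.

(** * Generator of the Fleming-Viot process *)

Lemma uniq_None_map (L : eqType) (A : seq L) : uniq A -> uniq (None :: map Some A).
Proof.
move=> uA; rewrite /= map_inj_uniq ?uA ?andbT; last by move=> ? ? [].
by apply/mapP => -[].
Qed.

Section particles.
Context {R : realType} {L : countType} {N : nat}.
Implicit Types (xi eta : {ffun 'I_N -> L}) (x y z : L) (i j : 'I_N).

Definition cnt xi x : R := (#|[set i | xi i == x]|)%:R.
Definition oth xi i x : R := (#|[set j | (j != i) && (xi j == x)]|)%:R.
Definition upd xi i z : {ffun 'I_N -> L} := [ffun j => if j == i then z else xi j].

Lemma cntE xi x : cnt xi x = \sum_i (xi i == x)%:R.
Proof.
rewrite /cnt -sum1_card natr_sum big_mkcond; apply: eq_bigr => i _.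
rewrite (_ : (i \in _) = (xi i == x)); first by case: eqP.
by apply/idP/idP => [/set_mem//|?]; exact/mem_set.
Qed.

Lemma othE xi i x : oth xi i x = cnt xi x - (xi i == x)%:R.
Proof.
rewrite /oth -sum1_card natr_sum cntE [in RHS](bigD1 i)//= [RHS]addrC addKr.
rewrite big_mkcond [RHS]big_mkcond; apply: eq_bigr => j _.
rewrite (_ : (j \in _) = (j != i) && (xi j == x)); first by case: eqP; case: eqP.
by apply/idP/idP => [/set_mem//|?]; exact/mem_set.
Qed.

Lemma cnt_upd xi i z x : cnt (upd xi i z) x = oth xi i x + (z == x)%:R.
Proof.
rewrite othE !cntE (bigD1 i)//= [in RHS](bigD1 i)//= ffunE eqxx.
rewrite (eq_bigr (fun j => (xi j == x)%:R)) => [|j ji]; first by ring.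
by rewrite ffunE (negPf ji).
Qed.

Lemma upd_id xi i : upd xi i (xi i) = xi.
Proof. by apply/ffunP => j; rewrite ffunE; case: eqP => // ->. Qed.

Lemma cnt_ge0 xi x : 0 <= cnt xi x. Proof. exact: ler0n. Qed.
Lemma oth_ge0 xi i x : 0 <= oth xi i x. Proof. exact: ler0n. Qed.

Lemma oth_le_cnt xi i x : oth xi i x <= cnt xi x.
Proof. by rewrite othE lerBlDr lerDl. Qed.

Lemma sum_particles (A : seq L) xi (h : L -> R) : uniq A ->
  (forall i, xi i \in A) -> \sum_i h (xi i) = \sum_(z <- A) cnt xi z * h z.
Proof.
move=> uA xiA; under [RHS]eq_bigr => z _ do rewrite cntE mulr_suml.
rewrite exchange_big/=; apply: eq_bigr => i _.
rewrite -[LHS](sum_pick h uA (xiA i)); apply: eq_bigr => z _.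
by rewrite mulrC eq_sym.
Qed.

Lemma sum_cnt (A : seq L) xi : uniq A -> (forall i, xi i \in A) ->
  \sum_(z <- A) cnt xi z = N%:R.
Proof.
move=> uA xiA; under eq_bigr do rewrite -[cnt _ _]mulr1.
by rewrite -(sum_particles (fun => 1))// sumr_const card_ord.
Qed.

Lemma sum_oth (A : seq L) xi i : uniq A -> (forall i, xi i \in A) ->
  \sum_(z <- A) oth xi i z = N%:R - 1.
Proof.
move=> uA xiA; under eq_bigr do rewrite othE.
rewrite sumrB sum_cnt//; congr (_ - _).
rewrite -[RHS](sum_pick (fun => 1) uA (xiA i)); apply: eq_bigr => z _.
by rewrite mul1r eq_sym.
Qed.

End particles.

Section fv_generator.
Context {R : realType} {L : countType} {N : nat}.
Variable q : option L -> option L -> R.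
Hypothesis q_ge0 : forall a b, a != b -> 0 <= q a b.
Hypothesis q_fin : forall a, (rate_total q a < +oo)%E.
Hypothesis q_diag : forall a, q a a = - fine (rate_total q a).
Hypothesis N2 : (2 <= N)%N.
Implicit Types (xi eta : {ffun 'I_N -> L}) (x y z : L) (i j : 'I_N).

Let kappa x := q (Some x) None.

(** With z = xi i included this is a whole row of the generator of particle i: the mass kappa sent
    to 0 is redistributed over the other particles, so the row sums to 0 over the sites. Landing on
    a companion at the same site is no jump and appears on the diagonal. *)
Definition particle_rate xi i z : R :=
  q (Some (xi i)) (Some z) + kappa (xi i) * oth xi i z / N.-1%:R.

Let N1_gt0 : 0 < N.-1%:R :> R.
Proof. by rewrite ltr0n -ltnS prednK// ltnW. Qed.

Let N1E : N%:R - 1 = N.-1%:R :> R.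
Proof. by rewrite -[in LHS](prednK (ltnW N2)) -natr1 addrK. Qed.

Let kappa_ge0 x : 0 <= kappa x. Proof. exact: q_ge0. Qed.

Lemma particle_rate_ge0 xi i z : z != xi i -> 0 <= particle_rate xi i z.
Proof.
move=> zi; rewrite addr_ge0//; last by rewrite divr_ge0 ?mulr_ge0 ?oth_ge0.
by apply: q_ge0; apply: contra zi => /eqP[->].
Qed.

Let jump xi eta i := [forall j, (j != i) ==> (xi j == eta j)] && (xi i != eta i).

Let fv_rateE xi eta : fv_rate q xi eta =
  \sum_(i < N) if jump xi eta i then particle_rate xi i (eta i) else 0.
Proof. by []. Qed.

Let jump_neq xi eta i : jump xi eta i -> eta i != xi i.
Proof. by move=> /andP[_]; rewrite eq_sym. Qed.

Let jump_upd xi eta i : jump xi eta i -> eta = upd xi i (eta i).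
Proof.
move=> /andP[/forallP H _]; apply/ffunP => j; rewrite ffunE.
by case: eqP => [->//|/eqP ji]; have := H j; rewrite ji => /eqP.
Qed.

Lemma fv_rate_ge0 xi eta : 0 <= fv_rate q xi eta.
Proof.
rewrite fv_rateE; apply: sumr_ge0 => i _; case: ifP => // /andP[_ H].
by apply: particle_rate_ge0; rewrite eq_sym.
Qed.

(** A jump of particle i is determined by its target, so eta -> eta i is injective on these jumps;
    the inequality accounts for targets that s leaves out. *)
Lemma fv_rate_sum_le (s : seq {ffun 'I_N -> L}) (B : seq L) xi
    (g : {ffun 'I_N -> L} -> R) : uniq s -> uniq B ->
  (forall eta i, eta \in s -> eta i \in B) -> (forall eta, 0 <= g eta) ->
  \sum_(eta <- s | eta != xi) fv_rate q xi eta * g eta <=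
  \sum_i \sum_(z <- B | z != xi i) particle_rate xi i z * g (upd xi i z).
Proof.
move=> us uB sB g0.
rewrite [leLHS](_ : _ = \sum_i \sum_(eta <- s | jump xi eta i)
    particle_rate xi i (eta i) * g (upd xi i (eta i))).
  apply: ler_sum => i _; rewrite -big_filter.
  set s' := [seq eta <- s | _].
  pose F z := particle_rate xi i z * g (upd xi i z).
  rewrite -(big_map (fun eta => eta i) predT F).
  have us' : uniq [seq eta i | eta : {ffun 'I_N -> L} <- s'].
    rewrite map_inj_in_uniq ?filter_uniq// => e1 e2.
    rewrite !mem_filter => /andP[/jump_upd E1 _] /andP[/jump_upd E2 _] E.
    by rewrite E1 E2 E.
  have uB' : uniq [seq z <- B | z != xi i] by rewrite filter_uniq.
  have sub : {subset [seq eta i | eta : {ffun 'I_N -> L} <- s']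
      <= [seq z <- B | z != xi i]}.
    move=> z /mapP[eta etas' ->].
    move: etas'; rewrite /s' (mem_filter _ _ s) => etas.
    have {etas}[je es] := andP etas.
    by rewrite mem_filter jump_neq// sB.
  rewrite -[leRHS]big_filter (sum_uniq_subset _ _ uB' us' sub) lerDl.
  rewrite big_seq_cond sumr_ge0// => z /and3P[]; rewrite mem_filter => /andP[zi _] _ _.
  by rewrite mulr_ge0 ?particle_rate_ge0.
under [RHS]eq_bigr do rewrite big_mkcond.
rewrite exchange_big big_mkcond/=; apply: eq_bigr => eta _.
have [->|_] := eqVneq eta xi.
  by rewrite big1// => i _; rewrite /jump eqxx andbF.
rewrite fv_rateE mulr_suml; apply: eq_bigr => i _.
by case: ifP => [/jump_upd <-//|_]; rewrite mul0r.
Qed.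

Lemma sum_particle_rate (B : seq L) xi i : uniq B -> (forall j, xi j \in B) ->
  \sum_(z <- B | z != xi i) particle_rate xi i z =
  \sum_(z <- B | z != xi i) q (Some (xi i)) (Some z) + kappa (xi i)
  - kappa (xi i) * oth xi i (xi i) / N.-1%:R.
Proof.
move=> uB xiB; rewrite big_split/= -addrA; congr (_ + _).
rewrite -mulr_suml -mulr_sumr.
have := sum_oth (R := R) i uB xiB; rewrite (bigD1_seq (xi i))//= N1E => H.
have -> : \sum_(z <- B | z != xi i) oth xi i z = N.-1%:R - oth xi i (xi i) :> R.
  by rewrite -H; ring.
by field; rewrite gt_eqF.
Qed.

Let row_split (B : seq L) x : uniq B ->
  \sum_(z <- B | z != x) q (Some x) (Some z) + kappa x =
  \sum_(a <- None :: map Some B | a != Some x) q (Some x) a.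
Proof. by move=> uB; rewrite big_cons/= big_map addrC. Qed.

Lemma sum_particle_rate_le (B : seq L) xi i : uniq B -> (forall j, xi j \in B) ->
  \sum_(z <- B | z != xi i) particle_rate xi i z <=
  - particle_rate xi i (xi i).
Proof.
move=> uB xiB; rewrite sum_particle_rate// row_split// opprD lerD2r q_diag opprK.
by apply: exit_rate_ge_seq => //; exact: uniq_None_map.
Qed.

Lemma fv_rate_fin xi : (rate_total (fv_rate q) xi < +oo)%E.
Proof.
apply: (@le_lt_trans _ _ (\sum_i - particle_rate xi i (xi i))%:E); last exact: ltry.
apply: esum_le_seq => s us sxi.
pose B := undup ([seq xi i | i : 'I_N] ++
  flatten [seq codom eta | eta : {ffun _ -> _} <- s]).
have uB : uniq B := undup_uniq _.
have xiB j : xi j \in B.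
  by rewrite mem_undup mem_cat; apply/orP; left; exact: codom_f.
apply: (@le_trans _ _ (\sum_(eta <- s | eta != xi) fv_rate q xi eta * 1)).
  rewrite le_eqVlt; apply/orP; left; apply/eqP.
  rewrite big_seq [RHS]big_seq_cond.
  apply: eq_big => [eta|eta _]; last by rewrite mulr1.
  by apply/idP/andP => [es|[]//]; split => //; exact: sxi.
apply: (le_trans (@fv_rate_sum_le s B xi (fun => 1) us uB _ _)) => [eta i es|//|].
  rewrite mem_undup mem_cat; apply/orP; right; apply/flattenP.
  by exists (codom eta); [exact: map_f|exact: codom_f].
apply: ler_sum => i _; under eq_bigr do rewrite mulr1.
exact: sum_particle_rate_le.
Qed.

Let fv_rate_upd xi i z : z != xi i -> particle_rate xi i z <= fv_rate q xi (upd xi i z).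
Proof.
move=> zi; rewrite fv_rateE (bigD1 i)//= ifT; last first.
  rewrite /jump ffunE eqxx eq_sym zi andbT; apply/forallP => j; apply/implyP => ji.
  by rewrite ffunE (negPf ji).
rewrite ffunE eqxx lerDl; apply: sumr_ge0 => j _; case: ifP => // /andP[_ H].
by apply: particle_rate_ge0; rewrite eq_sym.
Qed.

(** The direction needed to bound the diagonal of the killed generator from above. Different pairs
    (i, z) with z != xi i lead to different configurations, so their rates add up in the exit
    rate. *)
Lemma fv_exit_rate_ge xi :
  \sum_i - particle_rate xi i (xi i) <= exit_rate (fv_rate q) xi.
Proof.
apply/ler_addgt0Pr => e e0.
have n0 : 0 < N%:R :> R by rewrite ltr0n ltnW.
have e1 : 0 < e / N%:R by rewrite divr_gt0.
(* Finitely many targets exhaust each row up to e/N, hence all N rows together up to e. *)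
have /choice[F HF] : forall i, exists B : seq L, uniq B /\ forall B', uniq B' ->
    {subset B <= B'} -> - q (Some (xi i)) (Some (xi i)) - e / N%:R <=
      \sum_(z <- B' | z != xi i) q (Some (xi i)) (Some z) + kappa (xi i).
  move=> i; have [|l [ul li Hl]] := @esum_gt_seq R _ [set a | a != Some (xi i)]
     (q (Some (xi i))) (- q (Some (xi i)) (Some (xi i)) - e / N%:R).
    rewrite -[X in (_ < X)%E]/(rate_total q (Some (xi i))) -exit_rateE//.
    by rewrite q_diag opprK lte_fin ltrBlDr ltrDl.
  exists (undup (pmap id l)); split; first exact: undup_uniq.
  move=> B' uB' sB'; rewrite row_split//; apply: (le_trans (ltW Hl)).
  rewrite -[leRHS]big_filter.
  rewrite (@sum_uniq_subset _ _ [seq a <- None :: map Some B' | a != Some (xi i)] l).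
  - rewrite lerDl big_seq_cond sumr_ge0// => a /andP[].
    by rewrite mem_filter => /andP[ai _] _; rewrite q_ge0// eq_sym.
  - by rewrite filter_uniq// uniq_None_map.
  - by [].
  - move=> a al; rewrite mem_filter (li a al)/=.
    case: a al => [y|] al; last exact: mem_head.
    rewrite inE/= map_f//; apply: sB'; rewrite mem_undup mem_pmap.
    by rewrite map_id.
pose B := undup ([seq xi i | i : 'I_N] ++ flatten [seq F i | i : 'I_N]).
have uB : uniq B := undup_uniq _.
have xiB j : xi j \in B.
  by rewrite mem_undup mem_cat; apply/orP; left; exact: codom_f.
have FB i : {subset F i <= B}.
  move=> z zF; rewrite mem_undup mem_cat; apply/orP; right; apply/flattenP.
  by exists (F i) => //; apply: codom_f.
rewrite -lerBlDr.
apply: (@le_trans _ _ (\sum_i \sum_(z <- B | z != xi i) particle_rate xi i z)).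
  rewrite (_ : e = \sum_(i < N) e / N%:R); last first.
    by rewrite sumr_const card_ord -[RHS]mulr_natr divfK// gt_eqF.
  rewrite -sumrB; apply: ler_sum => i _; rewrite sum_particle_rate//.
  have [_ /(_ B uB (@FB i))] := HF i; rewrite /particle_rate.
  by set K := kappa _ * _ / _; lra.
pose pl := [seq (i, z) | i <- enum 'I_N, z <- [seq z <- B | z != xi i]].
have upl : uniq pl.
  apply: allpairs_uniq_dep; first exact: enum_uniq.
    by move=> i _; exact: filter_uniq.
  by move=> [i z] [j w] _ _ [-> ->].
have inj : {in pl &, injective (fun p => upd xi p.1 p.2)}.
  move=> [i z] [j w] /allpairsPdep[i' [z' [_ + [-> ->]]]].
  move=> + /allpairsPdep[j' [w' [_ + [-> ->]]]] /=.
  rewrite !mem_filter => /andP[zi _] /andP[wj _] /ffunP E.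
  have ij : i' = j'.
    apply/eqP; apply: contraT => ij; have := E i'; rewrite !ffunE eqxx (negPf ij).
    by move=> zE; rewrite zE eqxx in zi.
  by subst j'; have := E i'; rewrite !ffunE eqxx => ->.
rewrite -lee_fin exit_rateE; [|by move=> *; exact: fv_rate_ge0|exact: fv_rate_fin].
apply: le_trans (@esum_ge_seq R _ _ (fv_rate q xi)
  [seq upd xi p.1 p.2 | p <- pl] _ _); last first.
- move=> eta /mapP[[i z] /allpairsPdep[i' [z' [_ + [-> ->]]]] ->] /=.
  rewrite mem_filter => /andP[zi _]; apply: contra zi => /eqP/ffunP/(_ i').
  by rewrite ffunE eqxx => ->.
- by rewrite map_inj_in_uniq.
- rewrite lee_fin big_map big_allpairs_dep/= big_enum/=.
  apply: ler_sum => i _; rewrite big_filter; apply: ler_sum => z zi.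
  exact: fv_rate_upd.
Qed.

(* Killing at the boundary only lowers the generator on nonnegative functions. *)
Lemma fv_gen_le (s : seq {ffun 'I_N -> L}) (A : seq L) xi
    (g : {ffun 'I_N -> L} -> R) (al : 'I_N -> R) (b : 'I_N -> L -> R) :
  uniq s -> xi \in s -> uniq A -> (forall i, xi i \in A) ->
  (forall eta, 0 <= g eta) -> (forall i, 0 <= al i) ->
  (forall i z, z \notin A -> b i z = 0) ->
  (forall i z, g (upd xi i z) = al i + b i z) ->
  \sum_(eta <- s) gen (fv_rate q) xi eta * g eta <=
  \sum_i \sum_(z <- A) particle_rate xi i z * b i z.
Proof.
move=> us xis uA xiA g0 al0 bA gE; rewrite gen_sum//.
pose B := undup (A ++ flatten [seq codom eta | eta : {ffun _ -> _} <- s]).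
have uB : uniq B := undup_uniq _.
have AB : {subset A <= B} by move=> z zA; rewrite mem_undup mem_cat zA.
have sB eta i : eta \in s -> eta i \in B.
  move=> es; rewrite mem_undup mem_cat; apply/orP; right; apply/flattenP.
  by exists (codom eta); [exact: map_f|exact: codom_f].
have S12 := @fv_rate_sum_le s B xi g us uB sB g0.
suff : \sum_i \sum_(z <- B | z != xi i) particle_rate xi i z * g (upd xi i z) <=
    \sum_i \sum_(z <- A) particle_rate xi i z * b i z +
    (\sum_i - particle_rate xi i (xi i)) * g xi.
  have := ler_wpM2r (g0 xi) (fv_exit_rate_ge xi).
  move: S12; rewrite mulNr.
  set S1 := \sum_(_ <- _ | _) _; set S2 := \sum_i \sum_(_ <- A) _.
  set S3 := (\sum_i - _); lra.
rewrite mulr_suml -big_split/=; apply: ler_sum => i _.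
have gxi : g xi = al i + b i (xi i) by rewrite -gE upd_id.
rewrite gxi (bigD1_seq (xi i))//=.
under eq_bigr do rewrite gE mulrDr.
rewrite big_split/= -mulr_suml.
(* The part al i does not see the target, and row i, diagonal included, sums to at most 0 over B; as
   al i is nonnegative it can be discarded. *)
have h1 := ler_wpM2r (al0 i) (sum_particle_rate_le i uB (fun j => AB _ (xiA j))).
have -> : \sum_(z <- B | z != xi i) particle_rate xi i z * b i z =
    \sum_(z <- A | z != xi i) particle_rate xi i z * b i z.
  rewrite (sum_uniq_subset _ _ uB uA AB) [X in _ + X]big1 ?addr0// => z /andP[_ zA].
  by rewrite bA// mulr0.
by move: h1; set X := \sum_(_ <- _ | _) _; set Y := \sum_(_ <- _ | _) _; lra.
Qed.

End fv_generator.

(** * Drift of pair counts and of empirical frequencies *)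

Section fv_drift.
Context {R : realType} {L : countType} {N : nat}.
Variable q : option L -> option L -> R.
Hypothesis q_ge0 : forall a b, a != b -> 0 <= q a b.
Hypothesis q_fin : forall a, (rate_total q a < +oo)%E.
Hypothesis q_diag : forall a, q a a = - fine (rate_total q a).
Hypothesis N2 : (2 <= N)%N.
Implicit Types (xi eta : {ffun 'I_N -> L}) (x y z : L) (i j : 'I_N).

Let n : R := N%:R.

Let n2 : 2 <= n. Proof. by rewrite /n (ler_nat R 2). Qed.

Let n_gt0 : 0 < n. Proof. exact: lt_le_trans n2. Qed.

Let n1_gt0 : 0 < n - 1. Proof. by rewrite subr_gt0 (lt_le_trans _ n2)// ltr1n. Qed.

Let N1E : N.-1%:R = n - 1.
Proof. by rewrite /n -[in RHS](prednK (ltnW N2)) -natr1 addrK. Qed.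

(** The number of ordered pairs of distinct particles, the first at x and the second at y, divided
    by n^2; hence it is nonnegative. *)
Definition pairf xi x y : R :=
  emp R xi x * emp R xi y - (x == y)%:R * emp R xi x / n.

Definition loss (A : seq L) (f : L -> R) : R :=
  \sum_(z <- A) f z * q (Some z) None.

Lemma empE xi x : emp R xi x = cnt xi x / n.
Proof. by []. Qed.

Lemma emp_ge0 xi x : 0 <= emp R xi x.
Proof. by rewrite empE divr_ge0 ?cnt_ge0// ler0n. Qed.

Lemma emp_sum (A : seq L) xi : uniq A -> (forall i, xi i \in A) ->
  \sum_(z <- A) emp R xi z = 1.
Proof.
by move=> uA xiA; rewrite -mulr_suml sum_cnt// divff// gt_eqF.
Qed.

Lemma cnt_le xi x : cnt xi x <= n.
Proof.
rewrite cntE; apply: (@le_trans _ _ (\sum_(i < N) 1)).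
  by apply: ler_sum => i _; case: eqP.
by rewrite sumr_const card_ord.
Qed.

Lemma emp_le1 xi x : emp R xi x <= 1.
Proof. by rewrite empE ler_pdivrMr// mul1r cnt_le. Qed.

Let cnt_sqr_ge (k : nat) : (k%:R : R) <= k%:R * k%:R.
Proof. by rewrite -natrM ler_nat; case: k => // k; rewrite leq_pmulr. Qed.

Lemma pairf_ge0 xi x y : 0 <= pairf xi x y.
Proof.
have n0 := n_gt0.
rewrite /pairf !empE; have [->|_] := eqVneq x y; last first.
  by rewrite !mul0r subr0 !mulr_ge0 ?invr_ge0 ?cnt_ge0// ltW.
rewrite mul1r (_ : _ - _ = (cnt xi y * cnt xi y - cnt xi y) / n ^+ 2).
  by rewrite divr_ge0 ?exprn_ge0 ?(ltW n0)// subr_ge0 cnt_sqr_ge.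
by field; rewrite gt_eqF.
Qed.

Lemma pairfC xi x y : pairf xi x y = pairf xi y x.
Proof.
by rewrite /pairf eq_sym mulrC; case: eqP => [->//|_]; rewrite !mul0r.
Qed.

Section at_config.
Variables (s : seq {ffun 'I_N -> L}) (A : seq L) (xi : {ffun 'I_N -> L}).
Hypotheses (us : uniq s) (xis : xi \in s) (uA : uniq A) (xiA : forall i, xi i \in A).

Let loss_sum : \sum_i q (Some (xi i)) None = n * loss A (emp R xi).
Proof.
have n0 : n != 0 by rewrite gt_eqF.
rewrite (sum_particles (fun z => q (Some z) None) uA xiA) /loss mulr_sumr.
by apply: eq_bigr => z _; rewrite empE; field.
Qed.

Lemma loss_emp_ge0 : 0 <= loss A (emp R xi).
Proof. by apply: sumr_ge0 => z _; rewrite mulr_ge0 ?emp_ge0 ?q_ge0. Qed.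

(** Moves into x of the first particle of a pair whose second one sits at y. Since the two are
    distinct, the free moves give exactly the column sum of [pairf]; the selection moves are bounded
    through [oth] <= [cnt]. *)
Let cross_le x y : x \in A -> y \in A ->
  \sum_i particle_rate q xi i x * oth xi i y / n ^+ 2 <=
  \sum_(z <- A) q (Some z) (Some x) * pairf xi z y
  + n / (n - 1) * (emp R xi x * emp R xi y * loss A (emp R xi)).
Proof.
move=> xA yA.
have n0 := n_gt0; have n1 := n1_gt0.
rewrite (eq_bigr (fun i => q (Some (xi i)) (Some x) * oth xi i y / n ^+ 2 +
   q (Some (xi i)) None * (oth xi i x * oth xi i y / ((n - 1) * n ^+ 2)))); last first.
  by move=> i _; rewrite /particle_rate N1E; field; rewrite !gt_eqF.
rewrite big_split/= lerD//.
  under eq_bigr do rewrite othE.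
  rewrite (sum_particles (fun z =>
    q (Some z) (Some x) * (cnt xi y - (z == y)%:R) / n ^+ 2) uA xiA).
  rewrite le_eqVlt; apply/orP; left; apply/eqP; apply: eq_bigr => z _.
  by rewrite /pairf !empE; field; rewrite gt_eqF.
apply: (@le_trans _ _ (\sum_i q (Some (xi i)) None *
    (cnt xi x * cnt xi y / ((n - 1) * n ^+ 2)))).
  apply: ler_sum => i _; apply: ler_wpM2l; first exact: q_ge0.
  apply: ler_wpM2r; first by rewrite invr_ge0 mulr_ge0 ?exprn_ge0// ltW.
  by apply: ler_pM; rewrite ?oth_ge0 ?oth_le_cnt.
rewrite -mulr_suml loss_sum le_eqVlt; apply/orP; left; apply/eqP.
by rewrite !empE; field; rewrite !gt_eqF.
Qed.

Lemma fv_pair_drift x y : x \in A -> y \in A ->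
  \sum_(eta <- s) gen (fv_rate q) xi eta * pairf eta x y <=
  \sum_(z <- A) q (Some z) (Some x) * pairf xi z y
  + \sum_(z <- A) q (Some z) (Some y) * pairf xi x z
  + 2 * n / (n - 1) * (emp R xi x * emp R xi y * loss A (emp R xi)).
Proof.
move=> xA yA.
have n0 := n_gt0.
(* Up to n^2, al i counts the pairs avoiding particle i, and b i z those containing it when it sits
   at z. *)
pose al i := (oth xi i x * oth xi i y - (x == y)%:R * oth xi i x) / n ^+ 2 : R.
pose b i z := ((z == x)%:R * oth xi i y + (z == y)%:R * oth xi i x) / n ^+ 2 : R.
have al0 i : 0 <= al i.
  rewrite divr_ge0 ?exprn_ge0 ?(ltW n0)// subr_ge0.
  have [->|_] := eqVneq x y; rewrite ?mul1r ?mul0r; first exact: cnt_sqr_ge.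
  by rewrite mulr_ge0 ?oth_ge0.
have bA i z : z \notin A -> b i z = 0.
  move=> zA; have zx : (z == x) = false by apply/eqP => E; rewrite E xA in zA.
  have zy : (z == y) = false by apply/eqP => E; rewrite E yA in zA.
  by rewrite /b zx zy !mul0r addr0 mul0r.
have gE i z : pairf (upd xi i z) x y = al i + b i z.
  rewrite /pairf !empE !cnt_upd /al /b.
  have [->|xy] := eqVneq x y.
    by case: eqP => _ /=; field; rewrite gt_eqF.
  have [->|_] := eqVneq z x; first by rewrite (negPf xy) /=; field; rewrite gt_eqF.
  by rewrite /= !mulr0n; field; rewrite gt_eqF.
have g0 eta : 0 <= pairf eta x y by exact: pairf_ge0.
have := fv_gen_le q_ge0 q_fin q_diag N2 us xis uA xiA g0 al0 bA gE.
move=> /le_trans; apply.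
rewrite (_ : \sum_i _ = \sum_i particle_rate q xi i x * oth xi i y / n ^+ 2
   + \sum_i particle_rate q xi i y * oth xi i x / n ^+ 2).
  have := cross_le xA yA; have := cross_le yA xA.
  rewrite (eq_bigr (fun z => q (Some z) (Some y) * pairf xi x z)); last first.
    by move=> z _; rewrite pairfC.
  rewrite [emp R xi y * emp R xi x]mulrC => h1 h2.
  apply: (le_trans (lerD h2 h1)); rewrite le_eqVlt; apply/orP; left; apply/eqP.
  by set iv := (n - 1)^-1; ring.
rewrite -big_split/=; apply: eq_bigr => i _.
rewrite -(sum_pick (fun z => particle_rate q xi i z * oth xi i y / n ^+ 2) uA xA).
rewrite -(sum_pick (fun z => particle_rate q xi i z * oth xi i x / n ^+ 2) uA yA).
by rewrite -big_split/=; apply: eq_bigr => z _; rewrite /b; ring.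
Qed.

(** Frequencies enter the pair correlation with a negative sign, so they need a lower bound; passing
    to 1 - emp, which is nonnegative, turns it into an upper bound. The last term appears because a
    particle cannot jump onto itself. *)
Lemma fv_mean_drift x : x \in A ->
  \sum_(eta <- s) gen (fv_rate q) xi eta * (1 - emp R eta x) <=
  - \sum_(z <- A) q (Some z) (Some x) * emp R xi z
  - emp R xi x * loss A (emp R xi) + emp R xi x * q (Some x) None / (n - 1).
Proof.
move=> xA.
have n0 := n_gt0; have n1 := n1_gt0.
pose al i := 1 - oth xi i x / n : R.
pose b i z := - ((z == x)%:R / n) : R.
have al0 i : 0 <= al i.
  rewrite subr_ge0 ler_pdivrMr// mul1r.
  exact: le_trans (oth_le_cnt _ _ _) (cnt_le _ _).
have bA (i : 'I_N) z : z \notin A -> b i z = 0.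
  move=> zA; have zx : (z == x) = false by apply/eqP => E; rewrite E xA in zA.
  by rewrite /b zx mul0r oppr0.
have gE i z : 1 - emp R (upd xi i z) x = al i + b i z.
  by rewrite !empE !cnt_upd /al /b; field; rewrite gt_eqF.
have g0 eta : 0 <= 1 - emp R eta x by rewrite subr_ge0 emp_le1.
have := fv_gen_le q_ge0 q_fin q_diag N2 us xis uA xiA g0 al0 bA gE.
move=> /le_trans; apply.
rewrite (_ : \sum_i _ = \sum_i - (particle_rate q xi i x / n)); last first.
  apply: eq_bigr => i _.
  rewrite -(sum_pick (fun z => - (particle_rate q xi i z / n)) uA xA).
  by apply: eq_bigr => z _; rewrite /b; ring.
rewrite (eq_bigr (fun i => - (q (Some (xi i)) (Some x) / n)
   + - (cnt xi x / ((n - 1) * n)) * q (Some (xi i)) None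
   + q (Some (xi i)) None * (xi i == x)%:R / ((n - 1) * n))); last first.
  by move=> i _; rewrite /particle_rate N1E othE; field; rewrite !gt_eqF.
rewrite !big_split/= -mulr_sumr loss_sum.
rewrite (sum_particles (fun z => - (q (Some z) (Some x) / n)) uA xiA).
rewrite (sum_particles (fun z => q (Some z) None * (z == x)%:R / ((n - 1) * n)) uA xiA).
have -> : \sum_(z <- A) cnt xi z * (q (Some z) None * (z == x)%:R / ((n - 1) * n)) =
    emp R xi x * q (Some x) None / (n - 1) :> R.
  rewrite -[RHS](sum_pick (fun z => emp R xi z * q (Some z) None / (n - 1)) uA xA).
  by apply: eq_bigr => z _; rewrite empE; field; rewrite !gt_eqF.
rewrite lerD2r lerD//.
  rewrite -sumrN le_eqVlt; apply/orP; left; apply/eqP; apply: eq_bigr => z _.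
  by rewrite empE; field; rewrite gt_eqF.
rewrite mulNr lerN2 empE.
rewrite (_ : _ * (n * _) =
  n / (n - 1) * (cnt xi x / n * loss A (emp R xi))); last first.
  by field; rewrite !gt_eqF.
apply: ler_peMl.
  by rewrite mulr_ge0 ?loss_emp_ge0// divr_ge0 ?cnt_ge0// ltW.
by rewrite ler_pdivlMr// mul1r lerBlDr lerDl.
Qed.

End at_config.
End fv_drift.

(** * Conditioned evolution of the truncated chain *)

Lemma is_derive_inv (R : realType) (f : R -> R) (t d : R) : f t != 0 ->
  is_derive t 1 f d -> is_derive t 1 (fun u => (f u)^-1) (- (f t) ^- 2 * d).
Proof.
move=> ft [fd fE]; split; first exact: derivableV.
by rewrite deriveV// fE.
Qed.

Section flow.
Context {R : realType} {L : countType}.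
Variables (q : option L -> option L -> R) (P : R -> option L -> option L -> R).
Variables (C : R) (mu : L -> R) (A : seq L).
Hypothesis q_ge0 : forall a b, a != b -> 0 <= q a b.
Hypothesis q_fin : forall a, (rate_total q a < +oo)%E.
Hypothesis q_diag : forall a, q a a = - fine (rate_total q a).
Hypothesis q_None : forall b, q None b = 0.
Hypothesis HP : markov_transition q P.
Hypothesis q_kill : \sum_(z <- A) q (Some z) None <= C.
Hypothesis mu_ge0 : forall z, 0 <= mu z.
Hypothesis mu_sum : \sum_(z <- A) mu z <= 1.
Hypothesis uA : uniq A.

(* Dividing by the probability of not having been absorbed at 0, instead of the
   mass left in A, makes flow solve exactly the equation of the conditioned
   evolution. *)
Definition tlaw (t : R) (b : option L) : R :=
  \sum_(z <- A) mu z * trunc q (None :: map Some A) t (Some z) b.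

Definition flow (t : R) (x : L) : R := tlaw t (Some x) / (1 - tlaw t None).

Let uoA : uniq (None :: map Some A).
Proof. exact: uniq_None_map. Qed.

Let someA z : (Some z \in None :: map Some A) = (z \in A).
Proof. by rewrite inE /= mem_map// => ? ? []. Qed.

Lemma tlaw_ge0 t b : 0 <= t -> 0 <= tlaw t b.
Proof. by move=> t0; apply: sumr_ge0 => z _; rewrite mulr_ge0 ?trunc_ge0. Qed.

Lemma tlaw_sum t : 0 <= t -> \sum_(x <- A) tlaw t (Some x) <= 1 - tlaw t None.
Proof.
move=> t0; rewrite lerBrDr addrC /tlaw exchange_big -big_split/=.
apply: le_trans mu_sum; apply: ler_sum => z _; rewrite -mulr_sumr -mulrDr ler_piMr//.
have := trunc_sum_le1 q_ge0 q_fin HP (Some z) uoA uoA t0.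
by rewrite big_cons big_map.
Qed.

(** State 0 belongs to the truncated chain, so [tlaw t None] counts genuine absorption only and not
    the mass leaking out of A. *)
Lemma tlaw_deriv (t : R) b : b \in None :: map Some A ->
  is_derive t 1 (fun u => tlaw u b)
    (\sum_(y <- A) tlaw t (Some y) * q (Some y) b).
Proof.
move=> bA; pose oA := None :: map Some A.
have genE a c : gen q a c = q a c.
  by rewrite /gen; case: eqP => // ->; rewrite q_diag.
have D z : z \in A -> is_derive t 1
    (fun u => mu z * trunc q oA u (Some z) b)
    (mu z * \sum_(y <- A) trunc q oA t (Some z) (Some y) * q (Some y) b).
  move=> zA; have zoA : Some z \in oA by rewrite someA.
  have := @mexp_forward R _ (gen q) oA t (Some z) b uoA zoA bA.
  rewrite big_cons genE q_None mulr0 add0r big_map => H.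
  have := @is_deriveZ _ _ _ _ (mu z) t 1 _ H; rewrite /GRing.scale/=.
  move=> H'.
  rewrite (_ : (fun u => _) = mu z \*: (fun u => mexp (gen q) oA u (Some z) b)).
    apply: (is_derive_eq H'); congr (_ * _).
    rewrite big_seq [RHS]big_seq; apply: eq_bigr => y yA.
    by rewrite genE /trunc zoA someA yA.
  by apply/funext => u; rewrite /trunc zoA bA.
have := is_derive_sum_seq D => H; apply: (is_derive_eq H).
under [RHS]eq_bigr do rewrite /tlaw mulr_suml.
rewrite exchange_big/=; apply: eq_bigr => z _; rewrite mulr_sumr.
by apply: eq_bigr => y _; rewrite mulrA.
Qed.

Let C_ge0 : 0 <= C.
Proof. by apply: le_trans q_kill; apply: sumr_ge0 => z _; exact: q_ge0. Qed.

Let kill_le z : z \in A -> q (Some z) None <= C.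
Proof.
move=> zA; apply: le_trans q_kill; rewrite (big_rem z)//= lerDl.
by apply: sumr_ge0 => w _; exact: q_ge0.
Qed.

Lemma tlaw_init x : x \in A -> tlaw 0 (Some x) = mu x.
Proof.
move=> xA; rewrite -[RHS](sum_pick mu uA xA) /tlaw big_seq [RHS]big_seq.
by apply: eq_bigr => z zA; rewrite /trunc !someA zA xA mexp0.
Qed.

Lemma tlaw_init_None : tlaw 0 None = 0.
Proof.
rewrite /tlaw big_seq big1// => z zA.
by rewrite /trunc someA zA mexp0 mulr0.
Qed.

(** Every killing rate is at most C. The bound does not depend on A, which is what makes the
    quotients converge in [flow_cvg]. *)
Lemma survival_ge (t : R) : 0 <= t -> expR (- C * t) <= 1 - tlaw t None.
Proof.
move=> t0; rewrite -subr_ge0.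
pose dh (t : R) := (0 - \sum_(y <- A) tlaw t (Some y) * q (Some y) None)
   - (- C * expR (- C * t)).
pose h (t : R) := 1 - tlaw t None - expR (- C * t).
have hd (u : R) : is_derive u 1 h (dh u).
  have := tlaw_deriv u (mem_head _ _) => D1.
  have := is_derive_expRM (- C) u => D2.
  by apply: is_deriveB.
suff H (i : unit) (u : R) : i \in [:: tt] -> 0 <= u <= t -> 0 <= h u.
  by apply: (H tt t); rewrite ?mem_head// t0 lexx.
(* A scalar inequality, so the index list is a singleton; where h is nonpositive its derivative is
   nonnegative, and the constant can be 0. *)
apply: (@quasimonotone_ge0 R unit [:: tt] (fun=> h) (fun=> dh) 0 t) => {i u}.
- by move=> i _; exact: is_derive_right_cvg (hd 0).
- by move=> i _; rewrite /h tlaw_init_None mulr0 expR0; lra.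
- move=> i u b _ /andP[u0 _] b0 _ hu; rewrite mul0r oppr0 /dh.
  have H : \sum_(y <- A) tlaw u (Some y) * q (Some y) None <= C * (1 - tlaw u None).
    apply: (@le_trans _ _ (\sum_(y <- A) tlaw u (Some y) * C)).
      rewrite big_seq [leRHS]big_seq ler_sum// => y yA.
      by apply: ler_wpM2l; rewrite ?tlaw_ge0 ?kill_le// ltW.
    by rewrite -mulr_suml mulrC; apply: ler_wpM2l => //; exact/tlaw_sum/ltW.
  move: hu H; rewrite /h; have := C_ge0; set E := expR _; nra.
Qed.

Let surv_gt0 (t : R) : 0 <= t -> 0 < 1 - tlaw t None.
Proof. by move=> t0; apply: lt_le_trans (survival_ge t0); exact: expR_gt0. Qed.

Lemma flow_ge0 (t : R) x : 0 <= t -> 0 <= flow t x.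
Proof. by move=> t0; rewrite divr_ge0 ?tlaw_ge0// ltW ?surv_gt0. Qed.

Lemma flow_sum (t : R) : 0 <= t -> \sum_(x <- A) flow t x <= 1.
Proof.
by move=> t0; rewrite -mulr_suml ler_pdivrMr ?surv_gt0// mul1r tlaw_sum.
Qed.

Lemma flow_init x : x \in A -> flow 0 x = mu x.
Proof. by move=> xA; rewrite /flow tlaw_init// tlaw_init_None subr0 divr1. Qed.

(** Quotient rule: minus the logarithmic derivative of 1 - [tlaw t None] is the loss under [flow]
    itself, so the equation closes. *)
Lemma flow_deriv (t : R) x : 0 <= t -> x \in A ->
  is_derive t 1 (fun u => flow u x)
    (\sum_(y <- A) q (Some y) (Some x) * flow t y + flow t x * loss q A (flow t)).
Proof.
move=> t0 xA; have s0 := surv_gt0 t0.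
have D1 : is_derive t 1 (fun u => tlaw u (Some x)) _ :=
  tlaw_deriv t (etrans (someA x) xA).
have D2 : is_derive t 1 (fun u => tlaw u None) _ := tlaw_deriv t (mem_head _ _).
have D3 := is_deriveB (is_derive_cst (1 : R) t (1 : R)) D2.
have nz : (cst 1 - fun u => tlaw u None) t != 0 by rewrite gt_eqF.
have D4 := is_derive_inv nz D3.
have D5 := is_deriveM D1 D4.
apply: (is_derive_eq D5); rewrite /GRing.scale/= sub0r.
have -> : \sum_(y <- A) q (Some y) (Some x) * flow t y =
   (\sum_(y <- A) tlaw t (Some y) * q (Some y) (Some x)) / (1 - tlaw t None).
  by rewrite mulr_suml; apply: eq_bigr => y _; rewrite /flow; ring.
have -> : loss q A (flow t) =
   (\sum_(y <- A) tlaw t (Some y) * q (Some y) None) / (1 - tlaw t None).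
  by rewrite mulr_suml; apply: eq_bigr => y _; rewrite /flow; ring.
rewrite /flow; set X := \sum_(_ <- _) _; set Y := \sum_(_ <- _) _.
rewrite -[(cst 1 - _) t]/(1 - tlaw t None).
by field; rewrite gt_eqF.
Qed.

End flow.

(** * Pair correlations *)

Section moment_bound.
Context {R : realType} {L : countType} {N : nat}.
Variables (q : option L -> option L -> R) (C : R).
Variable PN : R -> {ffun 'I_N -> L} -> {ffun 'I_N -> L} -> R.
Hypothesis q_ge0 : forall a b, a != b -> 0 <= q a b.
Hypothesis q_fin : forall a, (rate_total q a < +oo)%E.
Hypothesis q_diag : forall a, q a a = - fine (rate_total q a).
Hypothesis N2 : (2 <= N)%N.
Hypothesis HPN : markov_transition (fv_rate q) PN.
Variables (s : seq {ffun 'I_N -> L}) (A : seq L) (xi0 : {ffun 'I_N -> L}).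
Hypotheses (us : uniq s) (uA : uniq A) (xi0s : xi0 \in s).
Hypothesis sA : forall xi i, xi \in s -> xi i \in A.
Hypothesis q_col : forall x, x \in A -> \sum_(z <- A) q (Some z) (Some x) <= C.
Hypothesis q_kill : \sum_(z <- A) q (Some z) None <= C.
Variable v : R -> L -> R.
Hypothesis v_ge0 : forall t x, 0 <= t -> 0 <= v t x.
Hypothesis v_sum : forall t, 0 <= t -> \sum_(x <- A) v t x <= 1.
Hypothesis v_deriv : forall (t : R) x, 0 <= t -> x \in A ->
  is_derive t 1 (fun u => v u x)
    (\sum_(y <- A) q (Some y) (Some x) * v t y + v t x * loss q A (v t)).

Let n : R := N%:R.
Let n_gt0 : 0 < n. Proof. by rewrite ltr0n ltnW. Qed.
Let n2 : 2 <= n. Proof. by rewrite /n (ler_nat R 2). Qed.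

Let C_ge0 : 0 <= C.
Proof. by apply: le_trans q_kill; apply: sumr_ge0 => z _; exact: q_ge0. Qed.

Let kill_le z : z \in A -> q (Some z) None <= C.
Proof.
move=> zA; apply: le_trans q_kill; rewrite (big_rem z)//= lerDl.
by apply: sumr_ge0 => w _; exact: q_ge0.
Qed.

Let v_le1 (t : R) x : 0 <= t -> x \in A -> v t x <= 1.
Proof.
move=> t0 xA; apply: le_trans (v_sum t0); rewrite (big_rem x)//= lerDl.
by apply: sumr_ge0 => z _; exact: v_ge0.
Qed.

Let loss_le (f : L -> R) : (forall z, 0 <= f z) -> \sum_(z <- A) f z <= 1 ->
  loss q A f <= C.
Proof.
move=> f0 f1; apply: (@le_trans _ _ (\sum_(z <- A) f z * C)).
  rewrite /loss big_seq [leRHS]big_seq ler_sum// => z zA.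
  by apply: ler_wpM2l => //; exact: kill_le.
by rewrite -mulr_suml ler_piMl.
Qed.

Let fv0 : forall x y : {ffun 'I_N -> L}, x != y -> 0 <= fv_rate q x y.
Proof. by move=> x y _; exact: fv_rate_ge0. Qed.

Let fvf : forall x : {ffun 'I_N -> L}, (rate_total (fv_rate q) x < +oo)%E.
Proof. by move=> x; exact: fv_rate_fin. Qed.

Let M (t : R) eta := trunc (fv_rate q) s t xi0 eta.

(** Expectation on the event that the particles have not left s, without renormalisation. *)
Definition texp (t : R) (g : {ffun 'I_N -> L} -> R) : R :=
  \sum_(eta <- s) trunc (fv_rate q) s t xi0 eta * g eta.

Let M_ge0 (t : R) eta : 0 <= t -> 0 <= M t eta.
Proof. exact: trunc_ge0. Qed.

Lemma texp_le (t : R) f g : 0 <= t -> (forall eta, eta \in s -> f eta <= g eta) ->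
  texp t f <= texp t g.
Proof.
move=> t0 fg; rewrite /texp big_seq [leRHS]big_seq ler_sum// => eta es.
by apply: ler_wpM2l; [exact: M_ge0|exact: fg].
Qed.

Lemma texpD (t : R) f g : texp t (fun eta => f eta + g eta) = texp t f + texp t g.
Proof. by rewrite /texp -big_split; apply: eq_bigr => eta _; rewrite mulrDr. Qed.

Lemma texpZ (t k : R) f : texp t (fun eta => k * f eta) = k * texp t f.
Proof. by rewrite /texp mulr_sumr; apply: eq_bigr => eta _; rewrite mulrCA. Qed.

Lemma texp_sum (t : R) (f : L -> {ffun 'I_N -> L} -> R) :
  texp t (fun eta => \sum_(z <- A) f z eta) = \sum_(z <- A) texp t (f z).
Proof.
rewrite /texp exchange_big; apply: eq_bigr => eta _; by rewrite mulr_sumr.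
Qed.

Let eq_texp (t : R) f g : (forall eta, f eta = g eta) -> texp t f = texp t g.
Proof. by move=> fg; apply: eq_bigr => eta _; rewrite fg. Qed.

Let mass (t : R) := texp t (fun=> 1).

Let mass_le1 (t : R) : 0 <= t -> mass t <= 1.
Proof.
move=> t0; rewrite /mass /texp; under eq_bigr do rewrite mulr1.
exact: (trunc_sum_le1 fv0 fvf HPN).
Qed.

Let texp0 g : texp 0 g = g xi0.
Proof.
rewrite /texp -(sum_pick g us xi0s) big_seq [RHS]big_seq.
by apply: eq_bigr => eta es; rewrite /trunc es xi0s mexp0 mulrC eq_sym.
Qed.

Lemma texp_deriv (t : R) g : is_derive t 1 (fun u => texp u g)
  (texp t (fun xi => \sum_(eta <- s) gen (fv_rate q) xi eta * g eta)).
Proof.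
have D eta : eta \in s -> is_derive t 1
    (fun u => trunc (fv_rate q) s u xi0 eta * g eta)
    (g eta * \sum_(xi <- s) M t xi * gen (fv_rate q) xi eta).
  move=> es; have := mexp_forward (gen (fv_rate q)) t us xi0s es => H.
  have H' := @is_deriveZ _ _ _ _ (g eta) t 1 _ H.
  rewrite (_ : (fun u => _) = g eta \*: (fun u => mexp (gen (fv_rate q)) s u xi0 eta)).
    apply: (is_derive_eq H'); rewrite /GRing.scale/=; congr (_ * _).
    rewrite big_seq [RHS]big_seq; apply: eq_bigr => xi xis.
    by rewrite /M /trunc xi0s xis.
  by apply/funext => u; rewrite /trunc xi0s es mulrC.
apply: (is_derive_eq (is_derive_sum_seq D)).
under eq_bigr do rewrite mulr_sumr.
rewrite exchange_big; apply: eq_bigr => xi _; rewrite mulr_sumr.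
by apply: eq_bigr => eta _; rewrite /M; ring.
Qed.

Let mass_drift xi : xi \in s -> \sum_(eta <- s) gen (fv_rate q) xi eta * 1 <= 0.
Proof.
move=> xis; rewrite gen_sum// mulr1.
under eq_bigr do rewrite mulr1.
by rewrite addrC subr_le0; exact: exit_rate_ge_seq.
Qed.

(** Makes the loss of mass at the final time a bound for the loss at all earlier times. *)
Let mass_nincr (t T : R) : 0 <= t <= T -> mass T <= mass t.
Proof.
move=> /andP[t0 tT].
have H u : 0 <= u -> texp u (fun xi => \sum_(eta <- s) gen (fv_rate q) xi eta * 1) <= 0.
  move=> u0; rewrite /texp big_seq sumr_le0// => eta es.
  by rewrite mulr_ge0_le0 ?mass_drift//; exact: M_ge0.
have := @nonincreasing_from0 R (fun u => mass (t + u))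
  (fun u => texp (t + u) (fun xi => \sum_(eta <- s) gen (fv_rate q) xi eta * 1))
  (T - t).
rewrite addr0; move=> /(_ _ _ _ (T - t)); rewrite (_ : t + (T - t) = T); last by ring.
have D (u : R) : is_derive u 1 (fun u => mass (t + u))
    (texp (t + u) (fun xi => \sum_(eta <- s) gen (fv_rate q) xi eta * 1)).
  have := @is_derive1_comp R mass (fun u => t + u) u _ 1 (texp_deriv (t + u) _).
  rewrite mulr1; apply.
  have := is_deriveD (is_derive_cst t u (1 : R)) (is_derive_id u (1 : R)).
  by rewrite add0r.
apply => //.
- by move=> u /andP[u0 _]; apply: H; rewrite addr_ge0// ltW.
- by have := is_derive_right_cvg (D 0); rewrite addr0.
- by rewrite subr_ge0 tT lexx.
Qed.

Let diff (t : R) (eta : {ffun 'I_N -> L}) x : R := emp R eta x - v t x.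

(** Equals diff x times diff y less the diagonal term; [pairf] has absorbed that term. *)
Let om (t : R) x y (eta : {ffun 'I_N -> L}) : R :=
  pairf eta x y - emp R eta x * v t y - v t x * emp R eta y + v t x * v t y.

(* Subtracting the mass lost by truncation makes the nonnegative functions
   pairf and 1 - emp the only ones whose killed drift has to be bounded. *)
Let W (t : R) (xy : L * L) : R := texp t (om t xy.1 xy.2) - (1 - mass t).

Let dv (t : R) x : R :=
  \sum_(y <- A) q (Some y) (Some x) * v t y + v t x * loss q A (v t).

Let dW (t : R) (xy : L * L) : R :=
  let: (x, y) := xy in
  texp t (fun xi => \sum_(eta <- s) gen (fv_rate q) xi eta * pairf eta x y)
  + (v t y * texp t (fun xi =>
        \sum_(eta <- s) gen (fv_rate q) xi eta * (1 - emp R eta x))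
     + texp t (fun xi => 1 - emp R xi x) * dv t y)
  + (v t x * texp t (fun xi =>
        \sum_(eta <- s) gen (fv_rate q) xi eta * (1 - emp R eta y))
     + texp t (fun xi => 1 - emp R xi y) * dv t x)
  + ((v t x * v t y - v t x - v t y + 1) *
        texp t (fun xi => \sum_(eta <- s) gen (fv_rate q) xi eta * 1)
     + mass t * (v t x * dv t y + v t y * dv t x - dv t x - dv t y)).

(** The coefficient of the mass is (1 - v x)(1 - v y). Thus [pairf], 1 - emp and 1 all enter with
    nonnegative coefficients, and upper bounds on their drifts suffice. *)
Let WE (t : R) x y : W t (x, y) =
  texp t (fun eta => pairf eta x y) + v t y * texp t (fun eta => 1 - emp R eta x)
  + v t x * texp t (fun eta => 1 - emp R eta y)
  + (v t x * v t y - v t x - v t y + 1) * mass t - 1.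
Proof.
rewrite /W/= -!texpZ -!texpD opprB addrCA addrA -texpD; congr (_ - 1).
by apply: eq_texp => eta; rewrite /om; ring.
Qed.

Let W_deriv (t : R) xy : 0 <= t -> xy.1 \in A -> xy.2 \in A ->
  is_derive t 1 (fun u => W u xy) (dW t xy).
Proof.
case: xy => x y /= t0 xA yA.
rewrite (_ : (fun u => _) =
   (fun u => texp u (fun eta => pairf eta x y)) +
   (fun u => v u y) * (fun u => texp u (fun eta => 1 - emp R eta x)) +
   (fun u => v u x) * (fun u => texp u (fun eta => 1 - emp R eta y)) +
   ((fun u => v u x) * (fun u => v u y) - (fun u => v u x) - (fun u => v u y) + cst 1) *
     mass - cst 1); last first.
  by apply/funext => u; rewrite WE.
have D1 := texp_deriv t (fun eta => pairf eta x y).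
have D2 := texp_deriv t (fun eta => 1 - emp R eta x).
have D3 := texp_deriv t (fun eta => 1 - emp R eta y).
have D4 : is_derive t 1 mass _ := texp_deriv t (fun=> 1).
have D5 := v_deriv t0 xA; have D6 := v_deriv t0 yA.
have D7 := is_derive_cst (1 : R) t (1 : R).
have D8 := is_deriveD (is_deriveB (is_deriveB (is_deriveM D5 D6) D5) D6) D7.
have D9 := is_deriveB (is_deriveD (is_deriveD (is_deriveD D1 (is_deriveM D6 D2))
   (is_deriveM D5 D3)) (is_deriveM D8 D4)) D7.
apply: (is_derive_eq D9); rewrite /GRing.scale/= subr0 addr0.
rewrite -[((fun u => v u x) * _ - _ - _ + _) t]/(v t x * v t y - v t x - v t y + 1).
by rewrite /dv; ring.
Qed.

Let sqd (t : R) x : R := texp t (fun eta => diff t eta x ^+ 2).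

(** Restoring the diagonal term costs at most 1/n, because a frequency is at most 1. *)
Let sqr_diff_le (t K : R) z : 0 <= t ->
  W t (z, z) + (1 - mass t) + n^-1 <= K -> sqd t z <= K.
Proof.
move=> t0 H; apply: le_trans H.
rewrite /W/= subrK -lerBlDl.
have := texpZ t (-1) (om t z z); rewrite mulN1r => <-.
rewrite addrC /sqd -texpD.
apply: (@le_trans _ _ (texp t (fun=> n^-1 * 1))).
  apply: texp_le => // eta _; rewrite /diff /om /pairf eqxx mul1r.
  have : emp R eta z * n^-1 <= 1 * n^-1.
    by rewrite ler_pM2r ?invr_gt0// emp_le1.
  rewrite -[N%:R]/n; set i := n^-1; nra.
by rewrite texpZ ler_piMr ?mass_le1// invr_ge0 ltW.
Qed.

Let om_sum (t : R) x y eta :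
  \sum_(z <- A) q (Some z) (Some x) * om t z y eta =
  \sum_(z <- A) q (Some z) (Some x) * pairf eta z y
  - (\sum_(z <- A) q (Some z) (Some x) * emp R eta z) * v t y
  - (\sum_(z <- A) q (Some z) (Some x) * v t z) * emp R eta y
  + (\sum_(z <- A) q (Some z) (Some x) * v t z) * v t y.
Proof.
rewrite !mulr_suml -!sumrB -big_split/=; apply: eq_bigr => z _.
by rewrite /om; ring.
Qed.

Let omC (t : R) x y eta : om t x y eta = om t y x eta.
Proof. by rewrite /om pairfC; ring. Qed.

Let loss_diff_le (t : R) x y eta : eta \in s ->
  emp R eta x * diff t eta y * (loss q A (emp R eta) - loss q A (v t)) <=
  \sum_(z <- A) q (Some z) None * ((diff t eta y ^+ 2 + diff t eta z ^+ 2) / 2).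
Proof.
move=> es; rewrite /loss -sumrB mulr_sumr.
apply: ler_sum => z _; rewrite -mulrBl mulrCA mulrA mulrC; apply: ler_wpM2l.
  exact: q_ge0.
rewrite -[_ - _]/(diff t eta z).
have := emp_ge0 (R := R) eta x; have := emp_le1 (R := R) N2 eta x.
set m := emp R eta x; set a := diff t eta y; set b := diff t eta z => m1 m0.
have h1 : 0 <= m * (a - b) ^+ 2 by rewrite mulr_ge0 ?sqr_ge0.
have h2 : 0 <= (1 - m) * (a ^+ 2 + b ^+ 2).
  by rewrite mulr_ge0 ?subr_ge0// addr_ge0 ?sqr_ge0.
nra.
Qed.

(** With D = m - v, selection contributes (m_x D_y + m_y D_x)(loss m - loss v) + 2 (loss v) D_x D_y.
    The first product is treated by [loss_diff_le], the second by loss v <= C. *)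
Let dW_le (t : R) x y : 0 <= t -> x \in A -> y \in A ->
  dW t (x, y) <=
  \sum_(z <- A) q (Some z) (Some x) * texp t (om t z y)
  + \sum_(z <- A) q (Some z) (Some y) * texp t (om t x z)
  + \sum_(z <- A) q (Some z) None *
      ((sqd t y + sqd t z) / 2)
  + \sum_(z <- A) q (Some z) None *
      ((sqd t x + sqd t z) / 2)
  + C * (sqd t x + sqd t y)
  + 8 * C / n.
Proof.
move=> t0 xA yA.
pose Phi eta :=
  \sum_(z <- A) q (Some z) (Some x) * om t z y eta
  + \sum_(z <- A) q (Some z) (Some y) * om t x z eta
  + \sum_(z <- A) q (Some z) None * ((diff t eta y ^+ 2 + diff t eta z ^+ 2) / 2)
  + \sum_(z <- A) q (Some z) None * ((diff t eta x ^+ 2 + diff t eta z ^+ 2) / 2)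
  + C * (diff t eta x ^+ 2 + diff t eta y ^+ 2) + 8 * C / n * 1.
apply: (@le_trans _ _ (texp t Phi)); last first.
  rewrite /Phi !texpD !texp_sum !texpZ !texpD.
  rewrite (eq_bigr (fun z => q (Some z) (Some x) * texp t (om t z y))); last first.
    by move=> z _; rewrite texpZ.
  rewrite [X in _ + X + _ + _ + _ + _](eq_bigr
    (fun z => q (Some z) (Some y) * texp t (om t x z))); last first.
    by move=> z _; rewrite texpZ.
  have half z w : texp t (fun eta =>
      q (Some z) None * ((diff t eta w ^+ 2 + diff t eta z ^+ 2) / 2)) =
      q (Some z) None * ((sqd t w + sqd t z) / 2).
    rewrite texpZ /sqd -texpD; congr (_ * _).
    by rewrite [RHS]mulrC -texpZ; apply: eq_texp => eta; rewrite mulrC.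
  under [X in _ + X + _ + _ + _ <= _]eq_bigr do rewrite half.
  under [X in _ + X + _ + _ <= _]eq_bigr do rewrite half.
  rewrite lerD2l ler_piMr ?mass_le1// divr_ge0 ?mulr_ge0//; exact: ltW.
pose g eta :=
  \sum_(z <- s) gen (fv_rate q) eta z * pairf z x y
  + v t y * (\sum_(z <- s) gen (fv_rate q) eta z * (1 - emp R z x))
  + v t x * (\sum_(z <- s) gen (fv_rate q) eta z * (1 - emp R z y))
  + (v t x * v t y - v t x - v t y + 1) * (\sum_(z <- s) gen (fv_rate q) eta z * 1)
  + dv t y * (1 - emp R eta x) + dv t x * (1 - emp R eta y)
  + (v t x * dv t y + v t y * dv t x - dv t x - dv t y) * 1.
rewrite (_ : dW t (x, y) = texp t g); last first.
  by rewrite /dW /g !texpD !texpZ !texpD -/(mass t); ring.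
apply: texp_le => // eta es.
have eA i : eta i \in A by exact: sA.
have h1 := fv_pair_drift q_ge0 q_fin q_diag N2 us es uA eA xA yA.
have h2 := fv_mean_drift q_ge0 q_fin q_diag N2 us es uA eA xA.
have h3 := fv_mean_drift q_ge0 q_fin q_diag N2 us es uA eA yA.
have h4 := mass_drift es.
have h5 := @loss_diff_le t x y eta es.
have h6 := @loss_diff_le t y x eta es.
have vx0 := v_ge0 x t0; have vy0 := v_ge0 y t0.
have vx1 := v_le1 t0 xA; have vy1 := v_le1 t0 yA.
have {h2}h2 := ler_wpM2l vy0 h2.
have {h3}h3 := ler_wpM2l vx0 h3.
have {h4}h4 : (v t x * v t y - v t x - v t y + 1) *
   (\sum_(z <- s) gen (fv_rate q) eta z * 1) <= 0.
  rewrite (_ : _ + 1 = (1 - v t x) * (1 - v t y)); last by ring.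
  by rewrite mulr_ge0_le0// mulr_ge0 ?subr_ge0.
have mx0 := emp_ge0 (R := R) eta x; have my0 := emp_ge0 (R := R) eta y.
have mx1 := emp_le1 (R := R) N2 eta x; have my1 := emp_le1 (R := R) N2 eta y.
have lm0 := loss_emp_ge0 q_ge0 A eta.
have lm1 : loss q A (emp R eta) <= C.
  by apply: loss_le => [z|]; rewrite ?emp_ge0 ?emp_sum.
have lv1 : loss q A (v t) <= C by apply: loss_le => [z|]; [exact: v_ge0|exact: v_sum].
have h7 : loss q A (v t) * (2 * (diff t eta x * diff t eta y)) <=
    C * (diff t eta x ^+ 2 + diff t eta y ^+ 2).
  have a0 : 0 <= diff t eta x ^+ 2 + diff t eta y ^+ 2 by rewrite addr_ge0 ?sqr_ge0.
  have lv0 : 0 <= loss q A (v t).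
    by apply: sumr_ge0 => z _; rewrite mulr_ge0 ?v_ge0 ?q_ge0.
  apply: (@le_trans _ _ (loss q A (v t) * (diff t eta x ^+ 2 + diff t eta y ^+ 2))).
    apply: ler_wpM2l => //; have := sqr_ge0 (diff t eta x - diff t eta y); nra.
  exact: ler_wpM2r.
have n1 : 0 < n - 1 by have := n2; lra.
(* Finite-N corrections: 2C from the factor n/(n - 1) of the pairs and C from each of the two means,
   all over n - 1; and 4C/(n - 1) <= 8C/n since n >= 2. *)
have h8 : 2 * n / (n - 1) * (emp R eta x * emp R eta y * loss q A (emp R eta))
   + v t y * (emp R eta x * q (Some x) None / (n - 1))
   + v t x * (emp R eta y * q (Some y) None / (n - 1)) <=
   2 * (emp R eta x * emp R eta y * loss q A (emp R eta)) + 8 * C / n.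
  have p01 (a b c : R) : 0 <= a -> a <= 1 -> 0 <= b -> b <= 1 -> 0 <= c -> c <= C ->
      a * b * c <= C.
    move=> a0 a1 b0 b1 c0 c1; apply: le_trans c1; rewrite ler_piMl//.
    by rewrite mulr_ile1.
  have e1 := p01 _ _ _ mx0 mx1 my0 my1 lm0 lm1.
  have e2 := p01 _ _ _ vy0 vy1 mx0 mx1 (q_ge0 (isT : Some x != None)) (kill_le xA).
  have e3 := p01 _ _ _ vx0 vx1 my0 my1 (q_ge0 (isT : Some y != None)) (kill_le yA).
  rewrite -lerBlDl (_ : _ - _ = (2 * (emp R eta x * emp R eta y * loss q A (emp R eta))
     + v t y * emp R eta x * q (Some x) None
     + v t x * emp R eta y * q (Some y) None) / (n - 1)); last first.
    by field; rewrite gt_eqF.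
  apply: (@le_trans _ _ (4 * C / (n - 1))).
    by apply: ler_wpM2r; [rewrite invr_ge0 ltW|lra].
  rewrite ler_pdivrMr// mulrAC ler_pdivlMr//.
  have := C_ge0; have := n2; nra.
move: h1 h2 h3 h5 h6 h7 h8.
rewrite /g /Phi.
have -> : \sum_(z <- A) q (Some z) (Some y) * om t x z eta =
    \sum_(z <- A) q (Some z) (Some y) * om t z x eta.
  by apply: eq_bigr => z _; rewrite omC.
have -> : \sum_(z <- A) q (Some z) (Some y) * pairf eta x z =
    \sum_(z <- A) q (Some z) (Some y) * pairf eta z x.
  by apply: eq_bigr => z _; rewrite pairfC.
rewrite !om_sum /dv -[N%:R]/n.
set S1 := \sum_(z <- A) q (Some z) (Some x) * pairf eta z y.
set S2 := \sum_(z <- A) q (Some z) (Some y) * pairf eta z x.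
set Mx := \sum_(z <- A) q (Some z) (Some x) * emp R eta z.
set My := \sum_(z <- A) q (Some z) (Some y) * emp R eta z.
set Vx := \sum_(z <- A) q (Some z) (Some x) * v t z.
set Vy := \sum_(z <- A) q (Some z) (Some y) * v t z.
set G1 := \sum_(z <- s) _ * pairf _ _ _.
set G2 := \sum_(z <- s) _ * (1 - emp R z x).
set G3 := \sum_(z <- s) _ * (1 - emp R z y).
move: h4; set G4 := \sum_(z <- s) _ * 1.
set Q1 := \sum_(z <- A) q (Some z) None * _.
set Q2 := \sum_(z <- A) q (Some z) None * _.
set lm := loss q A (emp R eta); set lv := loss q A (v t).
set E1 := 2 * n / _ * _; set E2 := emp R eta x * q _ _ / _.
set E3 := emp R eta y * q _ _ / _; set E4 := 8 * C / n.
rewrite /diff; set mx := emp R eta x; set my := emp R eta y.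
set vx := v t x; set vy := v t y.
move=> h4 h1 h2 h3 h5 h6 h7 h8.
nra.
Qed.

(** At a point x where G x has reached B, the nonpositive and possibly huge diagonal rate allows G x
    to be lowered to B. The column sum then multiplies B + r, and the overshoot b of the other
    entries costs only the off-diagonal rates. *)
Let column_le (B b r e : R) x (G : L -> R) : x \in A -> 0 <= B -> 0 <= r -> r <= e ->
  (forall z, z \in A -> G z <= B + b) -> B <= G x ->
  \sum_(z <- A) q (Some z) (Some x) * (G z + r) <=
  C * (B + e) + b * \sum_(z <- A | z != x) q (Some z) (Some x).
Proof.
move=> xA B0 r0 re GB BG.
apply: (@le_trans _ _ ((\sum_(z <- A) q (Some z) (Some x)) * (B + r) +
    b * \sum_(z <- A | z != x) q (Some z) (Some x))); last first.
  rewrite lerD2r; apply: (@le_trans _ _ (C * (B + r))).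
    by apply: ler_wpM2r; [rewrite addr_ge0|exact: q_col].
  by apply: ler_wpM2l => //; rewrite lerD2l.
rewrite (bigD1_seq x)//= [in leRHS](bigD1_seq x)//= mulrDl -addrA; apply: lerD.
  apply: ler_wnM2l; last by rewrite lerD2r.
  by rewrite q_diag oppr_le0; exact: exit_rate_ge0.
rewrite mulr_suml mulr_sumr -big_split/= big_seq_cond [leRHS]big_seq_cond.
apply: ler_sum => z /andP[zA zx]; rewrite [b * _]mulrC -mulrDr.
apply: ler_wpM2l; last by have := GB z zA; lra.
by apply: q_ge0; apply: contra zx => /eqP[->].
Qed.

Lemma fv_second_moment (d T : R) x : 0 <= T -> x \in A ->
  (forall z, z \in A -> `|emp R xi0 z - v 0 z| <= d) ->
  texp T (fun eta => (emp R eta x - v T x) ^+ 2) <=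
  expR (6 * C * T) * (d ^+ 2 + (1 - texp T (fun=> 1)) + 2 / n).
Proof.
move=> T0 xA hd; rewrite -/(mass T).
pose eps := 1 - mass T.
have eps0 : 0 <= eps by rewrite subr_ge0 mass_le1.
have in0 : 0 < n^-1 by rewrite invr_gt0.
pose K0 := d ^+ 2 + eps + 2 / n.
have d20 : 0 <= d ^+ 2 by exact: sqr_ge0.
(* B solves B' = 6C (B + eps + 2/n) with B(0) = d^2. Where W reaches B, the columns give 2C (B +
   eps), the squares 4C (B + eps + 1/n) and the corrections 8C/n, which add up to this right side;
   hence the constant 2/n. *)
pose B (t : R) : R := expR (6 * C * t) * K0 - (eps + 2 / n).
pose dB (t : R) : R := 6 * C * expR (6 * C * t) * K0.
have BD (t : R) : is_derive t 1 B (dB t).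
  have := @is_deriveZ _ _ _ _ K0 t 1 _ (is_derive_expRM (6 * C) t) => D1.
  have := is_deriveB D1 (is_derive_cst (eps + 2 / n : R) t (1 : R)) => D2.
  rewrite (_ : B = K0 \*: (fun t => expR (6 * C * t)) - cst (eps + 2 / n)).
    by apply: (is_derive_eq D2); rewrite subr0 /GRing.scale/= /dB mulrC.
  by apply/funext => u; rewrite /B mulrC.
have B0 t : 0 <= t -> 0 <= B t.
  move=> t0; have : 1 <= expR (6 * C * t).
    by rewrite -expR0 ler_expR mulr_ge0// mulr_ge0.
  rewrite /B /K0; set E := expR _; nra.
pose s2 := [seq (x, y) | x <- A, y <- A].
have s2P xy : xy \in s2 -> xy.1 \in A /\ xy.2 \in A.
  by move=> /allpairsP[[a b] /= [? ? ->]].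
have s2I a b : a \in A -> b \in A -> (a, b) \in s2.
  by move=> aA bA; apply/allpairsP; exists (a, b).
pose h xy t := B t - W t xy.
pose dh xy t := dB t - dW t xy.
pose c1 := \sum_(y <- A) \sum_(z <- A | z != y) q (Some z) (Some y).
have off0 y : 0 <= \sum_(z <- A | z != y) q (Some z) (Some y).
  by apply: sumr_ge0 => z zy; apply: q_ge0; apply: contra zy => /eqP[->].
have c1_ge y : y \in A -> \sum_(z <- A | z != y) q (Some z) (Some y) <= c1.
  by move=> yA; rewrite /c1 [leRHS](big_rem y)//= lerDl; apply: sumr_ge0.
have hD xy (t : R) : xy \in s2 -> 0 <= t -> is_derive t 1 (h xy) (dh xy t).
  move=> /s2P[aA bA] t0; have D1 := BD t; have D2 := W_deriv t0 aA bA.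
  exact: is_deriveB.
(* The overshoot b enters four times with factor C through K, and once through each of the two
   columns, whose off-diagonal parts are at most c1. *)
have step xy (t b : R) : xy \in s2 -> 0 < t <= T -> 0 <= b ->
    (forall j, j \in s2 -> - b <= h j t) -> h xy t <= 0 ->
    - ((2 * c1 + 4 * C) * b) <= dh xy t.
  case: xy => y w yws /andP[t0 tT] b0 hb hyw.
  have [/= yA wA] := s2P _ yws.
  have {}t0 := ltW t0.
  have r0 : 0 <= 1 - mass t by rewrite subr_ge0 mass_le1.
  have re : 1 - mass t <= eps by rewrite lerD2l lerN2; apply: mass_nincr; rewrite t0.
  have Wle z1 z2 : z1 \in A -> z2 \in A -> W t (z1, z2) <= B t + b.
    by move=> z1A z2A; have := hb _ (s2I _ _ z1A z2A); rewrite /h; lra.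
  have Bge : B t <= W t (y, w) by move: hyw; rewrite /h; lra.
  have omE z1 z2 : texp t (om t z1 z2) = W t (z1, z2) + (1 - mass t).
    by rewrite /W/= subrK.
  have h1 : \sum_(z <- A) q (Some z) (Some y) * texp t (om t z w) <=
      C * (B t + eps) + b * \sum_(z <- A | z != y) q (Some z) (Some y).
    under eq_bigr do rewrite omE.
    apply: (@column_le _ _ _ _ _ (fun z => W t (z, w)) yA (B0 t t0) r0 re _ Bge).
    by move=> z zA; exact: Wle.
  have h2 : \sum_(z <- A) q (Some z) (Some w) * texp t (om t y z) <=
      C * (B t + eps) + b * \sum_(z <- A | z != w) q (Some z) (Some w).
    under eq_bigr do rewrite omE.
    apply: (@column_le _ _ _ _ _ (fun z => W t (y, z)) wA (B0 t t0) r0 re _ Bge).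
    by move=> z zA; exact: Wle.
  pose K := B t + b + eps + n^-1.
  have sqK z : z \in A -> sqd t z <= K.
    move=> zA; apply: sqr_diff_le => //; have := Wle z z zA zA; rewrite /K; lra.
  have K0' : 0 <= K by have := B0 t t0; rewrite /K; lra.
  have kill z' : z' \in A -> \sum_(z <- A) q (Some z) None *
      ((sqd t z' + sqd t z) / 2) <= C * K.
    move=> z'A; apply: (@le_trans _ _ ((\sum_(z <- A) q (Some z) None) * K));
      last exact: ler_wpM2r.
    rewrite mulr_suml big_seq [leRHS]big_seq; apply: ler_sum => z zA.
    apply: ler_wpM2l; first exact: q_ge0.
    by have := sqK z zA; have := sqK z' z'A; lra.
  have h3 := kill w wA; have h4 := kill y yA.
  have h5 : C * (sqd t y + sqd t w) <= C * (2 * K).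
    by apply: ler_wpM2l => //; have := sqK _ yA; have := sqK _ wA; lra.
  have h6 := @dW_le t y w t0 yA wA.
  have h7 := ler_wpM2l b0 (c1_ge y yA); have h8 := ler_wpM2l b0 (c1_ge w wA).
  have dBE : dB t = 6 * C * (B t + eps + 2 / n) by rewrite /dB /B; ring.
  rewrite /dh dBE.
  move: h1 h2 h3 h4 h5 h6 h7 h8; rewrite /K.
  set S1 := \sum_(z <- A) _ * texp t (om t z w).
  set S2 := \sum_(z <- A) _ * texp t (om t y z).
  set S3 := \sum_(z <- A) q (Some z) None * _.
  set S4 := \sum_(z <- A) q (Some z) None * _.
  set S5 := C * (sqd _ _ + sqd _ _).
  set O1 := b * \sum_(z <- A | z != y) _; set O2 := b * \sum_(z <- A | z != w) _.
  set i := n^-1 => *; lra.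
have init xy : xy \in s2 -> 0 <= h xy 0.
  case: xy => y w /s2P[/= yA wA]; rewrite subr_ge0 /W /mass !texp0 subrr subr0 /=.
  rewrite /B mulr0 expR0 mul1r /K0 /om /pairf -[N%:R]/n.
  have h1 := hd y yA; have h2 := hd w wA.
  have h3 : (emp R xi0 y - v 0 y) * (emp R xi0 w - v 0 w) <= d ^+ 2.
    apply: (le_trans (ler_norm _)); rewrite normrM expr2.
    by apply: ler_pM.
  have h4 : 0 <= (y == w)%:R * emp R xi0 y / n.
    by rewrite !mulr_ge0 ?emp_ge0// ltW.
  move: h3 h4; set k := _ / n; set k2 := 2 / n; lra.
have HH : 0 <= h (x, x) T -> texp T (fun eta => (emp R eta x - v T x) ^+ 2) <=
    expR (6 * C * T) * (d ^+ 2 + eps + 2 / n).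
  rewrite subr_ge0 /B -/K0 => H; apply: sqr_diff_le => //.
  by move: H in0; rewrite -/eps; set i := n^-1; lra.
have dD xy (t : R) : xy \in s2 -> 0 < t <= T -> is_derive t 1 (h xy) (dh xy t).
  by move=> xys /andP[t0 _]; exact: hD xys (ltW t0).
have rc xy : xy \in s2 -> h xy @ 0^'+ --> h xy 0.
  by move=> xys; exact: is_derive_right_cvg (hD xy 0 xys (lexx 0)).
have TT : 0 <= T <= T by rewrite T0 lexx.
exact: HH (quasimonotone_ge0 dD rc init step (s2I x x xA xA) TT).
Qed.

(** Cauchy-Schwarz for a measure of mass at most 1, by expanding the square of |D| - e, where e is
    the first moment. *)
Lemma fv_first_moment (d T : R) x : 0 <= T -> x \in A ->
  (forall z, z \in A -> `|emp R xi0 z - v 0 z| <= d) ->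
  texp T (fun eta => `|emp R eta x - v T x|) ^+ 2 <=
  expR (6 * C * T) * (d ^+ 2 + (1 - texp T (fun=> 1)) + 2 / n).
Proof.
move=> T0 xA hd; apply: le_trans (fv_second_moment T0 xA hd).
set e := texp T (fun=> `|_|).
have : 0 <= texp T (fun eta => (`|emp R eta x - v T x| - e) ^+ 2).
  by apply: sumr_ge0 => eta _; rewrite mulr_ge0 ?sqr_ge0//; exact: M_ge0.
rewrite (_ : texp T _ = texp T (fun eta => (emp R eta x - v T x) ^+ 2) +
   (- 2 * e) * texp T (fun eta => `|emp R eta x - v T x|) + e ^+ 2 * mass T).
  by rewrite -/e; have := mass_le1 T0; have := sqr_ge0 e; nra.
rewrite -(texpZ T (- 2 * e)) -(texpZ T (e ^+ 2)) -!texpD; apply: eq_texp => eta.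
set a := emp R eta x - v T x.
have <- : `|a| ^+ 2 = a ^+ 2 by rewrite real_normK ?num_real.
by set c := `|a|; ring.
Qed.

End moment_bound.

(** * Removal of the truncation *)

Lemma ler_sum_subset (R : numDomainType) (I : eqType) (s l : seq I) (F : I -> R) :
  uniq s -> uniq l -> {subset l <= s} -> (forall z, 0 <= F z) ->
  \sum_(z <- l) F z <= \sum_(z <- s) F z.
Proof.
move=> us ul ls F0; rewrite [leRHS](sum_uniq_subset _ _ us ul ls) lerDl.
by apply: sumr_ge0 => z _; exact: F0.
Qed.

Lemma dist_le1 (R : realDomainType) (a b : R) :
  0 <= a <= 1 -> 0 <= b <= 1 -> `|a - b| <= 1.
Proof.
move=> /andP[? ?] /andP[? ?]; rewrite ler_norml; apply/andP; split; lra.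
Qed.

Section conditioned_limit.
Context {R : realType} {L : countType}.
Variables (q : option L -> option L -> R) (P : R -> option L -> option L -> R).
Variables (C : R) (mu : L -> R).
Hypothesis q_ge0 : forall a b, a != b -> 0 <= q a b.
Hypothesis q_fin : forall a, (rate_total q a < +oo)%E.
Hypothesis q_diag : forall a, q a a = - fine (rate_total q a).
Hypothesis q_None : forall b, q None b = 0.
Hypothesis HP : markov_transition q P.
Hypothesis q_kill : forall A, uniq A -> \sum_(z <- A) q (Some z) None <= C.
Hypothesis mu_ge0 : forall z, 0 <= mu z.
Hypothesis mu_sum : \esum_(z in [set: L]) (mu z)%:E = 1%E.
Variable t : R.
Hypothesis t0 : 0 <= t.

Let P_ge0 a b : 0 <= P t a b. Proof. exact: (markov_ge0 HP _ _ t0). Qed.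

Lemma mu_sum_le1 A : uniq A -> \sum_(z <- A) mu z <= 1.
Proof. by move=> uA; rewrite -lee_fin -mu_sum; exact: esum_ge_seq. Qed.

Let law b : R := fine (law_at mu P t b).

Let law_le1 b : (law_at mu P t b <= 1)%E.
Proof.
rewrite -mu_sum; apply: le_esum => z _; rewrite lee_fin ler_piMr//.
exact: (markov_le1 HP _ _ t0).
Qed.

Let lawE b : (law b)%:E = law_at mu P t b.
Proof.
rewrite fineK// fin_numE -ltey (le_lt_trans (law_le1 b)) ?ltry// andbT -ltNye.
apply: (lt_le_trans (ltNy0)); apply: esum_ge0 => z _.
by rewrite lee_fin mulr_ge0.
Qed.

Let law_ge_seq b A : uniq A -> \sum_(z <- A) mu z * P t (Some z) b <= law b.
Proof. by move=> uA; rewrite -lee_fin lawE; exact: esum_ge_seq. Qed.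

Let law_ge0 b : 0 <= law b.
Proof. by have := @law_ge_seq b [::] erefl; rewrite big_nil. Qed.

Let law_sum_le1 (H : seq (option L)) : uniq H -> \sum_(b <- H) law b <= 1.
Proof.
move=> uH; rewrite -lee_fin -sumEFin.
under eq_bigr do rewrite lawE.
rewrite -esum_sum => [|z b _ _]; last by rewrite lee_fin mulr_ge0.
rewrite -mu_sum; apply: le_esum => z _; rewrite sumEFin lee_fin -mulr_sumr ler_piMr//.
exact: (markov_sum_le1 HP _ uH t0).
Qed.

Let den : R := fine (\esum_(y in [set: L]) law_at mu P t (Some y)).

Let den_fin : (den)%:E = \esum_(y in [set: L]) (law (Some y))%:E.
Proof.
have E : \esum_(y in [set: L]) (law (Some y))%:E =
    \esum_(y in [set: L]) law_at mu P t (Some y).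
  by apply: eq_esum => y _; rewrite lawE.
rewrite /den -E fineK// fin_numE -ltey andbC -ltNye; apply/andP; split.
  apply: (@le_lt_trans _ _ 1%:E); last exact: ltry.
  apply: esum_le_seq => s us _.
  have := law_sum_le1 (uniq_None_map us); rewrite big_cons big_map.
  by have := law_ge0 None; lra.
by apply: (lt_le_trans (ltNy0)); apply: esum_ge0 => z _; rewrite lee_fin.
Qed.

Let rows_approx (e : R) (G : seq L) : 0 < e -> exists2 B : seq L, uniq B &
  forall z, z \in G -> 1 - e <= \sum_(b <- None :: map Some B) P t (Some z) b.
Proof.
move=> e0; elim: G => [|x G [B uB HB]]; first by exists [::].
have [|l [ul _ Hl]] := @esum_gt_seq R _ setT (P t (Some x)) (1 - e).
  by have [_ H _] := HP; rewrite H// lte_fin ltrBlDr ltrDl.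
pose B' := undup (B ++ pmap id l).
exists B' => [|z]; first exact: undup_uniq.
have uo := uniq_None_map (undup_uniq (B ++ pmap id l)).
rewrite inE => /predU1P[->|zG].
  apply: (le_trans (ltW Hl)).
  apply: ler_sum_subset => // -[w|] wl; last exact: mem_head.
  by rewrite inE/= map_f// mem_undup mem_cat mem_pmap map_id wl orbT.
apply: (le_trans (HB z zG)); apply: ler_sum_subset => //; first exact: uniq_None_map.
move=> b; rewrite !inE => /orP[->//|/mapP[w wB ->]].
by rewrite map_f ?orbT// mem_undup mem_cat wB.
Qed.

(** Uses honesty of P and total mass 1 of mu. It identifies the denominator of [cond_evol] as the
    limit of the one in [flow]. *)
Let denE : den = 1 - law None.
Proof.
apply/eqP; rewrite eq_le; apply/andP; split.
  rewrite -lee_fin den_fin; apply: esum_le_seq => s us _.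
  by have := law_sum_le1 (uniq_None_map us); rewrite big_cons big_map; lra.
apply/ler_addgt0Pr => e e0; rewrite lerBlDr.
have e2 : 0 < e / 2 by rewrite divr_gt0.
have [|G [uG _ HG]] := @esum_gt_seq R _ setT mu (1 - e / 2).
  by rewrite mu_sum lte_fin ltrBlDr ltrDl.
have [B uB HB] := rows_approx G e2.
have h1 : \sum_(b <- None :: map Some B) \sum_(z <- G) mu z * P t (Some z) b <=
    \sum_(b <- None :: map Some B) law b.
  by apply: ler_sum => b _; exact: law_ge_seq.
have h2 : \sum_(y <- B) law (Some y) <= den.
  by rewrite -lee_fin den_fin; exact: esum_ge_seq.
have h3 : \sum_(z <- G) mu z * (1 - e / 2) <=
    \sum_(b <- None :: map Some B) \sum_(z <- G) mu z * P t (Some z) b.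
  rewrite exchange_big/= big_seq [leRHS]big_seq; apply: ler_sum => z zG.
  by rewrite -mulr_sumr; apply: ler_wpM2l => //; exact: HB.
move: h3 h1; rewrite -mulr_suml [X in _ -> _ <= X -> _]big_cons big_map.
have := mu_sum_le1 uG; set S := \sum_(z <- G) mu z in HG *.
set Q := \sum_(_ <- _ :: _) _; set S2 := \sum_(_ <- _) _ in h2 *; nra.
Qed.

Let tlaw_le A b : uniq A -> tlaw q mu A t b <= law b.
Proof.
move=> uA; apply: le_trans (law_ge_seq b uA).
apply: ler_sum => z _; apply: ler_wpM2l => //; apply: trunc_le_sol => //.
  exact: uniq_None_map.
by have [] := HP.
Qed.

Let tlaw_approx (e : R) b : 0 < e -> exists A0 : seq L,
  forall A, uniq A -> {subset A0 <= A} -> law b - e <= tlaw q mu A t b.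
Proof.
move=> e0; have e2 : 0 < e / 2 by rewrite divr_gt0.
have [|G [uG _ HG]] :=
    @esum_gt_seq R _ setT (fun z => mu z * P t (Some z) b) (law b - e / 2).
  by rewrite -[X in (_ < X)%E]/(law_at mu P t b) -lawE lte_fin ltrBlDr ltrDl.
have [s0 H0] := trunc_approx q_ge0 q_fin HP [seq (Some z, b) | z <- G] e2 t0.
exists (G ++ pmap id s0) => A uA sA.
have GA : {subset G <= A} by move=> z zG; apply: sA; rewrite mem_cat zG.
have s0A : {subset s0 <= None :: map Some A}.
  move=> [w|] ws; last exact: mem_head.
  by rewrite inE/= map_f// sA// mem_cat mem_pmap map_id ws orbT.
have h1 z : z \in G ->
    P t (Some z) b - e / 2 <= trunc q (None :: map Some A) t (Some z) b.
  by move=> zG; apply: H0; rewrite ?uniq_None_map//; apply: map_f.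
have uo := uniq_None_map uA.
have h2 : \sum_(z <- G) mu z * (P t (Some z) b - e / 2) <= tlaw q mu A t b.
  apply: (@le_trans _ _
      (\sum_(z <- G) mu z * trunc q (None :: map Some A) t (Some z) b)).
    rewrite big_seq [leRHS]big_seq; apply: ler_sum => z zG.
    by apply: ler_wpM2l => //; exact: h1.
  by apply: ler_sum_subset => // z; rewrite mulr_ge0 ?trunc_ge0.
move: h2; under eq_bigr do rewrite mulrBr.
rewrite sumrB -mulr_suml; have := mu_sum_le1 uG; set S := \sum_(z <- G) mu z.
move: HG; set Q := \sum_(_ <- _) _; nra.
Qed.

Lemma flow_cvg (e : R) x : 0 < e -> exists A0 : seq L,
  forall A, uniq A -> {subset A0 <= A} ->
    `|flow q mu A t x - cond_evol mu P t x| <= e.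
Proof.
move=> e0; pose c := expR (- C * t).
have c0 : 0 < c by exact: expR_gt0.
have surv A : uniq A -> c <= 1 - tlaw q mu A t None.
  move=> uA; apply: (survival_ge q_ge0 q_fin q_diag q_None HP (q_kill uA) mu_ge0) => //.
  exact: mu_sum_le1.
(* Numerator and denominator are each off by at most k, and the denominators are at least c, so the
   quotients differ by at most 2k/c = e. *)
pose k := e * c / 2.
have k0 : 0 < k by rewrite divr_gt0 ?mulr_gt0.
have [A1 H1] := tlaw_approx (Some x) k0.
have [A2 H2] := tlaw_approx None k0.
exists (A1 ++ A2) => A uA sA.
have h1 : law (Some x) - k <= tlaw q mu A t (Some x).
  by apply: H1 => // z zA; apply: sA; rewrite mem_cat zA.
have h2 : law None - k <= tlaw q mu A t None.
  by apply: H2 => // z zA; apply: sA; rewrite mem_cat zA orbT.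
have h3 := tlaw_le (Some x) uA; have h4 := tlaw_le None uA.
have h5 := surv A uA.
have d0 : 0 < den.
  apply: (lt_le_trans c0); rewrite denE; apply/ler_addgt0Pr => e' e'0.
  have [A3 H3] := tlaw_approx None e'0.
  have := H3 _ (undup_uniq A3); have := surv _ (undup_uniq A3).
  by move=> ? H; have := H (fun z zA => etrans (mem_undup A3 z) zA); lra.
have h6 : law (Some x) <= den.
  rewrite -lee_fin den_fin.
  have := @esum_ge_seq R _ setT (fun y => law (Some y)) [:: x] erefl.
  by rewrite big_seq1; apply.
have h7 := law_ge0 (Some x).
rewrite /cond_evol -/(law (Some x)) -/den /flow.
move: h1 h2 h3 h4 h5 h6 h7 d0; rewrite denE.
set n1 := tlaw _ _ _ _ (Some x); set d1 := tlaw _ _ _ _ None.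
set n2 := law (Some x); set d2 := law None => h1 h2 h3 h4 h5 h6 h7 d0.
have d10 : 0 < 1 - d1 by exact: lt_le_trans h5.
(* Written so that the error of the denominator is multiplied by the limit quotient n2 / (1 - d2),
   which is at most 1. *)
rewrite (_ : _ - _ = ((n1 - n2) + n2 / (1 - d2) * (d1 - d2)) / (1 - d1)); last first.
  by field; rewrite !gt_eqF.
rewrite normrM normfV (gtr0_norm d10) ler_pdivrMr//.
have f0 : 0 <= n2 / (1 - d2) by rewrite divr_ge0// ltW.
have f1 : n2 / (1 - d2) <= 1 by rewrite ler_pdivrMr// mul1r.
apply: (@le_trans _ _ (k + k)).
  apply: (le_trans (ler_normD _ _)); apply: lerD.
    by rewrite ler_norml; apply/andP; split; lra.
  rewrite normrM (ger0_norm f0); apply: (@le_trans _ _ `|d1 - d2|).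
    exact: ler_piMl.
  by rewrite ler_norml; apply/andP; split; lra.
rewrite /k (_ : _ + _ = e * c); last by field.
by apply: ler_wpM2l => //; exact: ltW.
Qed.

End conditioned_limit.

(** Finiteness of the sum has to be established, since [fine] would send an infinite total variation
    to 0. *)
Lemma tv_ge (R : realType) (L : countType) (mu nu : L -> R) z :
  (forall z, 0 <= mu z) -> (forall z, 0 <= nu z) ->
  (forall s, uniq s -> \sum_(z <- s) mu z <= 1) ->
  (forall s, uniq s -> \sum_(z <- s) nu z <= 1) ->
  `|mu z - nu z| <= tv mu nu.
Proof.
move=> mu0 nu0 mu1 nu1; rewrite -lee_fin /tv fineK.
  have := @esum_ge_seq R _ setT (fun z => `|mu z - nu z|) [:: z] erefl.
  by rewrite big_seq1; apply.
rewrite fin_numE -ltey andbC -ltNye; apply/andP; split.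
  apply: (@le_lt_trans _ _ (1 + 1)%:E); last exact: ltry.
  apply: esum_le_seq => s us _.
  apply: le_trans (lerD (mu1 s us) (nu1 s us)); rewrite -big_split/=.
  apply: ler_sum => w _; have := mu0 w; have := nu0 w => h1 h2.
  by rewrite ler_norml; apply/andP; split; lra.
by apply: (lt_le_trans (ltNy0)); apply: esum_ge0 => w _; rewrite lee_fin.
Qed.

Lemma emp_sum_le1 (R : realType) (L : countType) (N : nat) (xi : {ffun 'I_N -> L})
    (s : seq L) : (2 <= N)%N -> uniq s -> \sum_(z <- s) emp R xi z <= 1.
Proof.
move=> N2 us; pose A := undup (s ++ codom xi).
rewrite -(@emp_sum R L N N2 A xi); [|exact: undup_uniq|]; last first.
  by move=> i; rewrite mem_undup mem_cat codom_f orbT.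
apply: ler_sum_subset => //; first exact: undup_uniq.
  by move=> z zs; rewrite mem_undup mem_cat zs.
by move=> z; exact: emp_ge0.
Qed.

Unset Implicit Arguments.

Theorem theorem2 (R : realType) (L : countType)
    (q : option L -> option L -> R) (P : R -> option L -> option L -> R)
    (C : R) (mu : L -> R) (N : nat) (xi0 : {ffun 'I_N -> L})
    (PN : R -> {ffun 'I_N -> L} -> {ffun 'I_N -> L} -> R) :
  (* Q is a conservative rate matrix with finite rates *)
  (forall a b, a != b -> 0 <= q a b) ->
  (forall a, (rate_total q a < +oo)%E) ->
  (forall a, q a a = - fine (rate_total q a)) ->
  (* 0 is absorbing *)
  (forall b, q None b = 0) ->
  (* P is the transition function of the non-exploding process Z *)
  markov_transition q P ->
  (* irreducible on Lambda *)
  (forall a b : L, exists t, 0 < t /\ 0 < P t (Some a) (Some b)) ->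
  (* absorption is certain *)
  (forall a : L, (fun t : R => P t (Some a) None) @ +oo --> (1 : R)) ->
  (* sum_{y in Lambda} q(y,x) <= C for all x in Lambda u {0} *)
  (forall b : option L,
     (\esum_(y in [set y : L | Some y != b]) (q (Some y) b)%:E
      + (if b is Some _ then q b b else 0)%:E <= C%:E)%E) ->
  (* mu is a probability measure on Lambda with finite mean jump rate *)
  (forall z, 0 <= mu z) ->
  \esum_(z in [set: L]) (mu z)%:E = 1%E ->
  (\esum_(z in [set: L]) (mu z * - q (Some z) (Some z))%:E < +oo)%E ->
  (2 <= N)%N ->
  (* PN is the transition function of the N-particle Fleming-Viot process *)
  markov_transition (fv_rate q) PN ->
  forall (T : R) (x : L), 0 < T ->
  forall t, 0 <= t <= T ->
    (\esum_(eta in [set: {ffun 'I_N -> L}])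
        (PN t xi0 eta * `|emp R eta x - cond_evol mu P t x|)%:E
     <= (expR (5 * C * T) * (3 / Num.sqrt N%:R + tv mu (emp R xi0)))%:E)%E.
Proof.
move=> q_ge0 q_fin q_diag q_None HP _ _ q_colE mu_ge0 mu_sum _ N2 HPN.
move=> T x T0 t /andP[t0 tT].
have col (b : option L) (s : seq L) : uniq s -> (forall y, y \in s -> Some y != b) ->
    \sum_(y <- s) q (Some y) b + (if b is Some _ then q b b else 0) <= C.
  move=> us sb; rewrite -lee_fin; apply: le_trans (q_colE b).
  by rewrite EFinD leeD2r//; apply: esum_ge_seq.
have q_kill (A : seq L) : uniq A -> \sum_(z <- A) q (Some z) None <= C.
  by move=> uA; have := col None A uA (fun _ _ => isT); rewrite addr0.
have q_col (A : seq L) y : uniq A -> y \in A -> \sum_(z <- A) q (Some z) (Some y) <= C.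
  move=> uA yA; rewrite (bigD1_seq y)//= addrC -big_filter.
  apply: (col (Some y)); first exact: filter_uniq.
  by move=> z; rewrite mem_filter => /andP[zy _]; apply: contra zy => /eqP[->].
have C0 : 0 <= C by have := q_kill [::] erefl; rewrite big_nil.
pose n : R := N%:R; have n0 : 0 < n by rewrite ltr0n ltnW.
have n1 : 1 <= n by rewrite /n ler1n ltnW.
pose d := tv mu (emp R xi0).
have tvle z : `|emp R xi0 z - mu z| <= d.
  rewrite distrC; apply: tv_ge => // [w|s us|s us]; first exact: emp_ge0.
    exact: mu_sum_le1.
  exact: emp_sum_le1.
have d0 : 0 <= d by apply: le_trans (tvle x).
(* Tolerance for both the lost mass and the distance to the untruncated expectation; order 1/n is
   enough, as it is absorbed in the 1/sqrt(n) term. *)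
pose k := (2 * n)^-1.
have k0 : 0 < k by rewrite invr_gt0 mulr_gt0.
apply: esum_le_seq => F uF _.
have fv0 : forall x y : {ffun 'I_N -> L}, x != y -> 0 <= fv_rate q x y.
  by move=> ? ? _; exact: fv_rate_ge0.
have fvf : forall x : {ffun 'I_N -> L}, (rate_total (fv_rate q) x < +oo)%E.
  by move=> ?; exact: fv_rate_fin.
have PN0 eta : 0 <= PN t xi0 eta by exact: (markov_ge0 HPN _ _ t0).
have k2 : 0 < k / 2 by rewrite divr_gt0.
have [|F1 [uF1 _ HF1]] := @esum_gt_seq R _ setT (PN t xi0) (1 - k / 2).
  by have [_ H _] := HPN; rewrite H// lte_fin ltrBlDr ltrDl.
pose F2 := undup (F ++ F1); have uF2 : uniq F2 := undup_uniq _.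
have FF2 : {subset F <= F2} by move=> z zF; rewrite mem_undup mem_cat zF.
have F1F2 : {subset F1 <= F2} by move=> z zF; rewrite mem_undup mem_cat zF orbT.
(* The pointwise errors over F2 add up to at most k/2; the successor avoids a division by 0. *)
pose e := k / 2 / (size F2).+1%:R.
have e0 : 0 < e by rewrite divr_gt0// ltr0Sn.
have [s0 Hs0] := trunc_approx fv0 fvf HPN [seq (xi0, eta) | eta <- F2] e0 t0.
pose s := undup (xi0 :: F2 ++ s0); have us : uniq s := undup_uniq _.
have F2s : {subset F2 <= s} by move=> z zF; rewrite mem_undup inE mem_cat zF orbT.
have xi0s : xi0 \in s by rewrite mem_undup mem_head.
have approx eta : eta \in F2 -> PN t xi0 eta <= trunc (fv_rate q) s t xi0 eta + e.
  move=> eF; rewrite -lerBlDr; apply: Hs0 => //; last exact: map_f.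
  by move=> z zs; rewrite mem_undup inE mem_cat zs !orbT.
have sume : \sum_(eta <- F2) e <= k / 2.
  rewrite big_const_seq count_predT iter_addr_0 -[e *+ _]mulr_natr.
  have <- : e * (size F2).+1%:R = k / 2 by rewrite /e divfK// pnatr_eq0.
  by apply: ler_wpM2l; [exact: ltW|rewrite ler_nat].
have tr0 eta : 0 <= trunc (fv_rate q) s t xi0 eta by exact: trunc_ge0.
have mass_ge : 1 - k <= texp q s xi0 t (fun=> 1).
  have h1 : \sum_(eta <- F1) PN t xi0 eta <= \sum_(eta <- F2) PN t xi0 eta.
    exact: ler_sum_subset.
  have h2 : \sum_(eta <- F2) PN t xi0 eta <=
      \sum_(eta <- F2) (trunc (fv_rate q) s t xi0 eta + e).
    by rewrite big_seq [leRHS]big_seq; exact: ler_sum.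
  have h3 : \sum_(eta <- F2) trunc (fv_rate q) s t xi0 eta <= texp q s xi0 t (fun=> 1).
    rewrite /texp; under [leRHS]eq_bigr do rewrite mulr1.
    exact: ler_sum_subset.
  by move: h2; rewrite big_split/=; lra.
have [A0 HA0] := flow_cvg q_ge0 q_fin q_diag q_None HP q_kill mu_ge0 mu_sum t0 x k2.
(* A is chosen after s: it contains all sites occupied in s, the point x, and the sites needed for
   the flow to be k/2-close to [cond_evol]. *)
pose A := undup (x :: A0 ++ flatten [seq codom eta | eta : {ffun _ -> _} <- s]).
have uA : uniq A := undup_uniq _.
have xA : x \in A by rewrite mem_undup mem_head.
have sA (eta : {ffun 'I_N -> L}) i : eta \in s -> eta i \in A.
  move=> es; rewrite mem_undup inE mem_cat; apply/orP; right; apply/orP; right.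
  by apply/flattenP; exists (codom eta); [exact: map_f|exact: codom_f].
have vV : `|flow q mu A t x - cond_evol mu P t x| <= k / 2.
  by apply: HA0 => // z zA; rewrite mem_undup inE mem_cat zA orbT.
have mu1 := mu_sum_le1 mu_sum uA.
pose v := flow q mu A.
have v0 u y : 0 <= u -> 0 <= v u y.
  exact: (flow_ge0 q_ge0 q_fin q_diag q_None HP (q_kill A uA) mu_ge0 mu1 uA).
have v1 u : 0 <= u -> \sum_(y <- A) v u y <= 1.
  exact: (flow_sum q_ge0 q_fin q_diag q_None HP (q_kill A uA) mu_ge0 mu1 uA).
have vd (u : R) y : 0 <= u -> y \in A -> is_derive u 1 (fun w => v w y)
    (\sum_(z <- A) q (Some z) (Some y) * v u z + v u y * loss q A (v u)).
  exact: (flow_deriv q_ge0 q_fin q_diag q_None HP (q_kill A uA) mu_ge0 mu1 uA).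
have init z : z \in A -> `|emp R xi0 z - v 0 z| <= d.
  by move=> zA; rewrite /v flow_init.
have := fv_first_moment q_ge0 q_fin q_diag N2 HPN us uA xi0s sA
  (fun y => @q_col A y uA) (q_kill A uA) v0 v1 vd t0 xA init.
set E := texp _ _ _ _ _; set mass := texp _ _ _ _ _ in mass_ge * => HE.
have E0 : 0 <= E by apply: sumr_ge0 => eta _; rewrite mulr_ge0.
have vx1 : v t x <= 1.
  apply: le_trans (v1 t t0); rewrite (big_rem x)//= lerDl.
  by apply: sumr_ge0 => z _; exact: v0.
have dist_le (eta : {ffun 'I_N -> L}) :
    `|emp R eta x - cond_evol mu P t x| <= `|emp R eta x - v t x| + k / 2.
  by apply: (le_trans (ler_distD (v t x) _ _)); rewrite lerD2l.
have dist1 (eta : {ffun 'I_N -> L}) : `|emp R eta x - v t x| <= 1.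
  by rewrite dist_le1 ?emp_ge0 ?emp_le1 ?v0.
have main : \sum_(eta <- F) PN t xi0 eta * `|emp R eta x - cond_evol mu P t x| <= E + k.
  apply: (@le_trans _ _ (\sum_(eta <- F2)
      (trunc (fv_rate q) s t xi0 eta * `|emp R eta x - v t x| + e
        + k / 2 * PN t xi0 eta))).
    apply: le_trans (ler_sum_subset uF2 uF FF2 _) _ => [eta|]; first exact: mulr_ge0.
    rewrite big_seq [leRHS]big_seq; apply: ler_sum => eta eF.
    have h1 := ler_wpM2l (PN0 eta) (dist_le eta).
    have h2 := ler_wpM2r (normr_ge0 (emp R eta x - v t x)) (approx eta eF).
    have h3 := ler_wpM2l (ltW e0) (dist1 eta).
    by move: h1 h2 h3; set a := `|emp R eta x - v t x|; nra.
  rewrite !big_split/= -[X in _ + X <= _]mulr_sumr.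
  have h1 : \sum_(eta <- F2)
      trunc (fv_rate q) s t xi0 eta * `|emp R eta x - v t x| <= E.
    by apply: ler_sum_subset => // eta; rewrite mulr_ge0.
  have h2 := markov_sum_le1 HPN xi0 uF2 t0.
  have h3 := ler_wpM2l (ltW k2) h2.
  by move: h1 h3 sume; lra.
apply: (le_trans main); rewrite -/d -/n.
have sn0 : 0 < Num.sqrt n by rewrite sqrtr_gt0.
pose w := (Num.sqrt n)^-1; have w0 : 0 < w by rewrite invr_gt0.
have w2 : w ^+ 2 = n^-1 by rewrite exprVn sqr_sqrtr// ltW.
have kw : k = w ^+ 2 / 2 by rewrite w2 /k; field; rewrite gt_eqF.
have w1 : w <= 1.
  by rewrite invf_le1// -[leLHS](sqrtr1 R) ler_wsqrtr.
pose X := expR (5 * C * T).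
have X1 : 1 <= X by rewrite -expR0 ler_expR !mulr_ge0// ltW.
(* With w = 1/sqrt(n) the bracket is at most d^2 + w^2/2 + 2 w^2, which is below (d + 2w)^2. *)
have EX : E ^+ 2 <= (X * (d + 2 * w)) ^+ 2.
  apply: (le_trans HE).
  have h1 : expR (6 * C * t) <= X ^+ 2.
    rewrite -expRM_natl ler_expR.
    have : C * t <= C * T by exact: ler_wpM2l.
    have : 0 <= C * T by rewrite mulr_ge0// ltW.
    lra.
  have h2 : 1 - mass <= k by lra.
  rewrite exprMn; apply: ler_pM; rewrite ?expR_ge0//.
    have : mass <= 1.
      rewrite /mass /texp; under eq_bigr do rewrite mulr1.
      exact: (trunc_sum_le1 fv0 fvf HPN).
    have : 0 <= 2 / N%:R :> R by rewrite divr_ge0.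
    have := sqr_ge0 d; set a := 2 / N%:R; lra.
  rewrite -/n -w2 kw in h2 *.
  by move: h2; nra.
have {}EX : E <= X * (d + 2 * w).
  rewrite -ler_sqr ?nnegrE//.
  by rewrite mulr_ge0 ?expR_ge0// addr_ge0// mulr_ge0// ltW.
(* The third 1/sqrt(n) pays for the truncation error: k = w^2/2 <= w <= X w. *)
rewrite kw -/w -/X; nra.
Qed.
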